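(* Let $n\ge 4$ and let $K$ be an infinite field of characteristic $p\ge n$, with $p\geq 5$. Then the T-ideal $T^{(3)}=T^{(3)}(F_2^{(n)})$ of the algebra $F_2^{(n)}$ possesses a T-normal series. In particular, every T-space of $F_2^{(n)}$ contained in $T^{(3)}$ has a finite system of generators (as a T-space).
   Context: Commutators: $[a_1,a_2]=a_1a_2-a_2a_1$ and $[a_1,\dots,a_n]=[[a_1,\dots,a_{n-1}],a_n]$. For a unital associative algebra $A$, $T^{(m)}(A)$ is the two-sided ideal generated by all $[a_1,\dots,a_m]$, $a_i\in A$. $F_2$ is the free unital associative $K$-algebra on $x,y$ and $F_2^{(n)}=F_2/T^{(n)}(F_2)$. A T-space of a relatively free algebra $A$ is a $K$-subspace closed under all unital algebra endomorphisms of $A$; the T-space generated by a set is the smallest T-space containing it. Let $U$ be a T-space of a relatively free algebra $A$. A T-composition series of $U$ is a finite sequence of T-spaces $0=U_0\subset U_1\subset\dots\subset U_k\subset U_{k+1}=U$ such that each factor $U_{i+1}/U_i$ contains no proper T-spaces, i.e. there is no T-space of $A$ strictly between $U_i$ and $U_{i+1}$. A T-composition series is called T-normal if all its members $U_i$ are ideals of $A$. *)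

(* Defs.v *)
From HB Require Import structures.
From mathcomp Require Import all_boot all_algebra.
From mathcomp Require Import generic_quotient ring_quotient.
From mathcomp Require Import boolp classical_sets cardinality.
From mathcomp Require Import monalg.

Set Implicit Arguments.
Unset Strict Implicit.
Unset Printing Implicit Defensive.

Import GRing.Theory.

Local Open Scope ring_scope.
Local Open Scope classical_set_scope.

Section Definitions.
Variables (K : comNzRingType) (A : algType K).
Implicit Types (U W G : set A) (V : nat -> set A).

Definition comm (a b : A) : A := a * b - b * a.

(* Left-normed; a one-term commutator is the term itself, the empty one is 0. *)
Definition lcomm (s : seq A) : A := if s is a :: s' then foldl comm a s' else 0.

(* Two-sided; closure under opposites and scaling follows, A being unital. *)
Definition ideal U : Prop :=
  [/\ U 0,
      forall u v, U u -> U v -> U (u + v),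
      forall a u, U u -> U (a * u)
    & forall a u, U u -> U (u * a)].

(* T^(m)(A): [smallest C G] is the intersection of all sets in C containing G. *)
Definition Tcomm (m : nat) : set A :=
  smallest ideal [set lcomm (tval t) | t in [set: m.-tuple A]].

Definition subspace U : Prop :=
  [/\ U 0,
      forall u v, U u -> U v -> U (u + v)
    & forall (c : K) u, U u -> U (c *: u)].

Definition Tspace U : Prop :=
  subspace U /\ forall (f : {lrmorphism A -> A}) u, U u -> U (f u).

Definition Tspan G : set A := smallest Tspace G.

(* V 0 < V 1 < ... < V k.+1; the values of V beyond k.+1 are irrelevant. *)
Definition Tcomposition_series U (k : nat) V : Prop :=
  [/\ V 0%N = [set 0],
      V k.+1 = U,
      forall i, (i <= k.+1)%N -> Tspace (V i)
    & forall i, (i <= k)%N ->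
        V i `<` V i.+1 /\
        ~ exists W, [/\ Tspace W, V i `<` W & W `<` V i.+1]].

Definition Tnormal_series U (k : nat) V : Prop :=
  Tcomposition_series U k V /\ forall i, (i <= k.+1)%N -> ideal (V i).

End Definitions.

Arguments Tcomm {K A} m.
Arguments Tspan {K A} G.

Lemma ideal_Tcomm (K : comNzRingType) (A : algType K) m :
  ideal (@Tcomm K A m).
Proof.
split.
- by move=> U [[]].
- move=> u v Tu Tv U UP; have [[_ UD _ _] _] := UP.
  by apply: UD; [exact: Tu|exact: Tv].
- by move=> a u Tu U UP; have [[_ _ + _] _] := UP; apply; exact: Tu.
- by move=> a u Tu U UP; have [[_ _ _ +] _] := UP; apply; exact: Tu.
Qed.

(* Quotient of an algebra by a proper two-sided ideal; the library only has
   ring quotients of commutative rings.  Idealr already gives properness and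
   stability under left multiplication. *)
HB.mixin Record isRightStable (R : nzRingType) (S : R -> bool) := {
  right_stable : forall a u, u \in S -> u * a \in S
}.

HB.structure Definition TwoSidedIdeal (R : nzRingType) :=
  {S of Idealr R S & isRightStable R S}.

Section AlgQuotient.
Variables (K : comNzRingType) (A : algType K) (I : TwoSidedIdeal.type A).
Local Open Scope quotient_scope.

Definition alg_quot := Quotient.quot I.
HB.instance Definition _ := Choice.on alg_quot.
HB.instance Definition _ := GRing.Zmodule.on alg_quot.

Let pi (a : A) : alg_quot := \pi_(Quotient.quot I) a.

Let piP a b : reflect (pi a = pi b) (a - b \in I).
Proof. by rewrite Quotient.idealrBE; exact: eqP. Qed.

Let piK (q : alg_quot) : pi (repr (q : Quotient.quot I)) = q.
Proof. exact: (@reprK _ (Quotient.quot I)). Qed.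

Let piD a b : pi (a + b) = pi a + pi b.
Proof. exact: (raddfD (\pi_(Quotient.quot I))). Qed.

Let rep (q : alg_quot) : A := repr (q : Quotient.quot I).

Definition alg_quot_mul (q r : alg_quot) : alg_quot := pi (rep q * rep r).
Definition alg_quot_scale (c : K) (q : alg_quot) : alg_quot := pi (c *: rep q).

Let repB a : rep (pi a) - a \in I.
Proof. by apply/piP; rewrite piK. Qed.

Let piM a b : pi (a * b) = alg_quot_mul (pi a) (pi b).
Proof.
apply/esym/piP.
rewrite -[X in X - _](subrK (a * rep (pi b))) -mulrBl -addrA -mulrBr.
by apply: rpredD; [exact/right_stable/repB|exact/idealMr/repB].
Qed.

Let piZ c a : pi (c *: a) = alg_quot_scale c (pi a).
Proof.
apply/esym/piP; rewrite -scalerBr -[_ - _]mul1r scalerAl.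
by apply/idealMr/repB.
Qed.

Fact alg_quot_mulA : associative alg_quot_mul.
Proof. by move=> x y z; rewrite -[x]piK -[y]piK -[z]piK -!piM mulrA. Qed.

Fact alg_quot_mul1 : left_id (pi 1) alg_quot_mul.
Proof. by move=> x; rewrite -[x]piK -piM mul1r. Qed.

Fact alg_quot_mulr1 : right_id (pi 1) alg_quot_mul.
Proof. by move=> x; rewrite -[x]piK -piM mulr1. Qed.

Fact alg_quot_mulDl : left_distributive alg_quot_mul +%R.
Proof.
by move=> x y z; rewrite -[x]piK -[y]piK -[z]piK -piD -!piM -piD mulrDl.
Qed.

Fact alg_quot_mulDr : right_distributive alg_quot_mul +%R.
Proof.
by move=> x y z; rewrite -[x]piK -[y]piK -[z]piK -piD -!piM -piD mulrDr.
Qed.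

Fact alg_quot_oner_neq0 : pi 1 != 0.
Proof.
have -> : 0 = pi 0 by apply/esym; exact: (raddf0 (\pi_(Quotient.quot I))).
by apply/eqP => /piP; rewrite subr0 idealr1.
Qed.

HB.instance Definition _ := GRing.Zmodule_isNzRing.Build alg_quot
  alg_quot_mulA alg_quot_mul1 alg_quot_mulr1 alg_quot_mulDl alg_quot_mulDr
  alg_quot_oner_neq0.

Fact alg_quot_scaleA c d x :
  alg_quot_scale c (alg_quot_scale d x) = alg_quot_scale (c * d) x.
Proof. by rewrite -[x]piK -!piZ scalerA. Qed.

Fact alg_quot_scale1 : left_id 1 alg_quot_scale.
Proof. by move=> x; rewrite -[x]piK -piZ scale1r. Qed.

Fact alg_quot_scaleDr : right_distributive alg_quot_scale +%R.
Proof. by move=> c x y; rewrite -[x]piK -[y]piK -piD -!piZ -piD scalerDr. Qed.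

Fact alg_quot_scaleDl x : {morph alg_quot_scale^~ x : c d / c + d}.
Proof. by move=> c d /=; rewrite -[x]piK -!piZ -piD scalerDl. Qed.

HB.instance Definition _ := GRing.Zmodule_isLmodule.Build K alg_quot
  alg_quot_scaleA alg_quot_scale1 alg_quot_scaleDr alg_quot_scaleDl.

Fact alg_quot_scaleAl (c : K) (x y : alg_quot) : c *: (x * y) = c *: x * y.
Proof.
change (alg_quot_scale c (alg_quot_mul x y)
        = alg_quot_mul (alg_quot_scale c x) y).
by rewrite -[x]piK -[y]piK -piM -!piZ -piM scalerAl.
Qed.

HB.instance Definition _ :=
  GRing.Lmodule_isLalgebra.Build K alg_quot alg_quot_scaleAl.

Fact alg_quot_scaleAr (c : K) (x y : alg_quot) : c *: (x * y) = x * (c *: y).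
Proof.
change (alg_quot_scale c (alg_quot_mul x y)
        = alg_quot_mul x (alg_quot_scale c y)).
by rewrite -[x]piK -[y]piK -piM -!piZ -piM scalerAr.
Qed.

HB.instance Definition _ :=
  GRing.Lalgebra_isAlgebra.Build K alg_quot alg_quot_scaleAr.

Definition alg_pi (a : A) : alg_quot := pi a.

Fact alg_pi_nmod : nmod_morphism alg_pi.
Proof.
by split; [exact: (raddf0 (\pi_(Quotient.quot I)))|exact: piD].
Qed.

Fact alg_pi_monoid : monoid_morphism alg_pi.
Proof. by split; [|exact: piM]. Qed.

Fact alg_pi_scalable : scalable alg_pi.
Proof. exact: piZ. Qed.

HB.instance Definition _ := GRing.isNmodMorphism.Build A alg_quot alg_pi
  alg_pi_nmod.
HB.instance Definition _ := GRing.isMonoidMorphism.Build A alg_quot alg_pi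
  alg_pi_monoid.
HB.instance Definition _ := GRing.isScalable.Build K A alg_quot *:%R alg_pi
  alg_pi_scalable.

Lemma alg_pi_surj q : exists a, alg_pi a = q.
Proof. by exists (rep q); exact: piK. Qed.

Lemma alg_pi_eq0 a : (alg_pi a == 0) = (a \in I).
Proof.
rewrite -(raddf0 alg_pi) -[in RHS](subr0 a).
by apply/eqP/idP => /piP.
Qed.

End AlgQuotient.

(* Free unital associative algebra on two generators: the monoid algebra of the
   free monoid on 'I_2. *)
Definition F2 (K : comNzRingType) := {malg K[{fmonom 'I_2}]}.
HB.instance Definition _ (K : comNzRingType) := GRing.Lalgebra.on (F2 K).

Fact F2_scaleAr (K : comNzRingType) (c : K) (u v : F2 K) :
  c *: (u * v) = u * (c *: v).
Proof.
have malgC_comm (w : F2 K) : w * c%:MP = c%:MP * w.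
  rewrite [w]monalgE mulr_suml mulr_sumr; apply: eq_bigr => k _.
  by rewrite !malgM_def !fgmulUU mulm1 mul1m mulrC.
by rewrite -!mul_malgC mulrA -malgC_comm -mulrA.
Qed.

HB.instance Definition _ (K : comNzRingType) :=
  GRing.Lalgebra_isAlgebra.Build K (F2 K) (@F2_scaleAr K).

(* The proof argument is not used in the body: it lets the instances below
   assume n > 1, as T^(1)(F_2) = F_2 is not proper and algebras are nontrivial
   in the library. *)
Definition F2_Tcomm (K : comNzRingType) (n : nat) (n_gt1 : (1 < n)%N) :
  F2 K -> bool := fun u => `[< @Tcomm K (F2 K) n u >].

Section TcommProper.
Variables (K : comNzRingType) (n : nat) (n_gt1 : (1 < n)%N).

Let T := @Tcomm K (F2 K) n.

Let aug : {rmorphism {malg K[{fmonom 'I_2}]} -> K} :=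
  @mcoeff {fmonom 'I_2} K mone.

Let augM (u v : F2 K) : aug (u * v) = aug u * aug v.
Proof. exact: (rmorphM aug). Qed.

Let augD (u v : F2 K) : aug (u + v) = aug u + aug v.
Proof. exact: (rmorphD aug). Qed.

Let augB (u v : F2 K) : aug (u - v) = aug u - aug v.
Proof. exact: (rmorphB aug). Qed.

Let aug_comm (u v : F2 K) : aug (comm u v) = 0.
Proof.
apply: (etrans (augB (u * v) (v * u))).
apply/eqP; rewrite subr_eq0; apply/eqP.
by apply: (etrans (augM u v)); apply: (etrans (mulrC _ _)); apply/esym/augM.
Qed.

Let aug_lcomm (s : seq (F2 K)) : (1 < size s)%N -> aug (lcomm s) = 0.
Proof.
case: s => [|a s] //; case/lastP: s => [|s b] // _.
by rewrite /lcomm foldl_rcons; apply: aug_comm.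
Qed.

Let Tcomm_aug u : T u -> aug u = 0.
Proof.
move=> /(_ [set v | aug v = 0]); apply; split; last first.
  by move=> _ [t _ <-]; apply: aug_lcomm; rewrite size_tuple.
split=> [|x y x0 y0|a x x0|a x x0].
- exact: (rmorph0 aug).
- change (aug (x + y) = 0); by rewrite augD x0 y0 addr0.
- change (aug (a * x) = 0); by rewrite augM x0 mulr0.
- change (aug (x * a) = 0); by rewrite augM x0 mul0r.
Qed.

Fact F2_Tcomm_zmod_closed : zmod_closed (@F2_Tcomm K n n_gt1).
Proof.
have [T0 TD Tl _] := ideal_Tcomm (F2 K) n.
split=> [|u v /asboolP Tu /asboolP Tv]; apply/asboolP => //.
by apply: TD => //; rewrite -mulN1r; apply: Tl.
Qed.

Fact F2_Tcomm_proper :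
  (1 \notin @F2_Tcomm K n n_gt1) /\
  (forall a, {in @F2_Tcomm K n n_gt1, forall u, a * u \in @F2_Tcomm K n n_gt1}).
Proof.
have [_ _ Tl _] := ideal_Tcomm (F2 K) n.
split; last first.
  by move=> a u /asboolP Tu; apply/asboolP; apply: Tl.
by apply/asboolP => /Tcomm_aug /eqP; rewrite (rmorph1 aug) oner_eq0.
Qed.

Fact F2_Tcomm_right a u :
  u \in @F2_Tcomm K n n_gt1 -> u * a \in @F2_Tcomm K n n_gt1.
Proof.
have [_ _ _ Tr] := ideal_Tcomm (F2 K) n.
by move=> /asboolP Tu; apply/asboolP; apply: Tr.
Qed.

HB.instance Definition _ := GRing.isZmodClosed.Build (F2 K)
  (@F2_Tcomm K n n_gt1) F2_Tcomm_zmod_closed.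
HB.instance Definition _ := isProperIdeal.Build (F2 K)
  (@F2_Tcomm K n n_gt1) F2_Tcomm_proper.
HB.instance Definition _ := isRightStable.Build (F2 K)
  (@F2_Tcomm K n n_gt1) F2_Tcomm_right.

End TcommProper.

(* F_2^(n) = F_2 / T^(n)(F_2) *)
Definition F2rel (K : comNzRingType) (n : nat) (n_gt1 : (1 < n)%N) : algType K :=
  @alg_quot K (F2 K) (@F2_Tcomm K n n_gt1).
Arguments F2rel K [n] n_gt1.

(* Main.v *)
Require Import Defs.
From HB Require Import structures.
From mathcomp Require Import all_boot all_algebra zify ring.
From mathcomp Require Import finmap.
From mathcomp Require Import boolp classical_sets cardinality.
From mathcomp Require Import monalg.
From Stdlib Require Ncring Ncring_tac.

(** Write [A = F_2^(n)], generated by [x] and [y].  Let [P_d] be the T-ideal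
    spanned by the [a * w] with [w] a product of commutators in [x], [y] of total
    degree at least [d].  Two facts hold because there are only two generators:
    [T^(m), A] lies in [T^(m+1)], and consequently a product of commutators of
    degree [k] in [x] (or in [y]) lies in [T^(k+1)].  So such products vanish in
    [A] unless both degrees are at most [n - 2 <= p - 2], and [P_(2n) = 0].

    On [P_d / P_(d+1)] the substitutions [x -> x + s h], [y -> y + s g] act to
    first order in [s] like polynomial vector fields on a tensor field module:
    [K[x,y]] acts by multiplication, and gl_2 acts on the products of commutators
    of degree [d].  For [d >= 3] the bound on the degrees keeps the relevant
    Casimir values nonzero in [K], which implies that a T-space [U] between
    [P_(d+1)] and [P_d] containing a product of commutators [w] contains all the
    [x^a y^b w].  Together with the substitutions [x -> x + s] and [y -> y + s]
    this shows that [U] is an ideal determined by its intersection with a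
    finite-dimensional space, so the chain of the [T^(3)] `&` [P_d] refines to a
    finite T-normal series.  Generators of a T-space below [T^(3)] are read off
    from this series, one for each factor that the T-space meets. *)

Set Implicit Arguments.
Unset Strict Implicit.
Unset Printing Implicit Defensive.

Import GRing.Theory.

Local Open Scope ring_scope.
Local Open Scope classical_set_scope.

(** * Normalisation of identities in noncommutative rings *)

Section NonCommutativeRing.
Variable R : nzRingType.

#[local] Instance ncring_ops :
  @Ncring.Ring_ops R 0 1 +%R *%R (fun x y => x - y) -%R eq := {}.

#[local] Instance ncring_ring :
  @Ncring.Ring R 0 1 +%R *%R (fun x y => x - y) -%R eq ncring_ops.
Proof.
split=> //; first exact: RelationClasses.eq_equivalence.
all: try by move=> ? ? -> ? ? ->.
- by move=> ? ? ->.
- exact: add0r.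
- exact: addrC.
- exact: addrA.
- exact: mul1r.
- exact: mulr1.
- exact: mulrA.
- exact: mulrDl.
- by move=> a b c; exact: mulrDr.
- exact: subrr.
Qed.

End NonCommutativeRing.

#[local] Existing Instance ncring_ops.
#[local] Existing Instance ncring_ring.

Ltac ncring := rewrite /comm; Ncring_tac.non_commutative_ring.

(** * Commutator ideals of a two-generated algebra *)

Section Ideals.
Variables (K : comNzRingType) (A : algType K) (J : set A).
Hypothesis idJ : ideal J.
Implicit Types u v a : A.

Lemma ideal0 : J 0. Proof. by case: idJ. Qed.
Lemma idealD u v : J u -> J v -> J (u + v). Proof. by case: idJ => _ + _ _; apply. Qed.
Lemma ideal_mull a u : J u -> J (a * u). Proof. by case: idJ => _ _ + _; apply. Qed.
Lemma ideal_mulr u a : J u -> J (u * a). Proof. by case: idJ => _ _ _ +; apply. Qed.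
Lemma idealN u : J u -> J (- u). Proof. by rewrite -mulN1r; exact: ideal_mull. Qed.
Lemma idealB u v : J u -> J v -> J (u - v).
Proof. by move=> Ju Jv; apply: idealD => //; exact: idealN. Qed.
Lemma idealZ (c : K) u : J u -> J (c *: u).
Proof. by move=> Ju; rewrite -[u]mul1r scalerAl; exact: ideal_mull. Qed.
Lemma ideal_comm u a : J u -> J (comm u a).
Proof. by move=> Ju; apply: idealB; [exact: ideal_mulr|exact: ideal_mull]. Qed.
Lemma ideal_subspace : subspace J.
Proof. by split; [exact: ideal0|exact: idealD|exact: idealZ]. Qed.

End Ideals.

Section CommutatorIdeals.
Variables (K : comNzRingType) (A : algType K).
Implicit Types (a b c u v : A) (s : seq A).

Lemma commvv a : comm a a = 0. Proof. by rewrite /comm subrr. Qed.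

Lemma commN a b : comm a b = - comm b a. Proof. by ncring. Qed.

Lemma commDl a b c : comm (a + b) c = comm a c + comm b c.
Proof. by ncring. Qed.

Lemma commDr a b c : comm a (b + c) = comm a b + comm a c.
Proof. by ncring. Qed.

Lemma commMl a b c : comm (a * b) c = a * comm b c + comm a c * b.
Proof. by ncring. Qed.

Lemma commMr a b c : comm a (b * c) = b * comm a c + comm a b * c.
Proof. by ncring. Qed.

Lemma commZl (k : K) a b : comm (k *: a) b = k *: comm a b.
Proof. by rewrite /comm -scalerAl -scalerAr scalerBr. Qed.

Lemma commZr (k : K) a b : comm a (k *: b) = k *: comm a b.
Proof. by rewrite /comm -scalerAl -scalerAr scalerBr. Qed.

Lemma commA a (k : K) : comm a k%:A = 0.
Proof. by rewrite commZr /comm mulr1 mul1r subrr scaler0. Qed.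

Lemma lcomm_rcons s a : s != [::] -> lcomm (rcons s a) = comm (lcomm s) a.
Proof. by case: s => //= b s _; rewrite foldl_rcons. Qed.

Lemma Tcomm_lcomm s : Tcomm (size s) (lcomm s).
Proof. by move=> J [_ sub]; apply: sub; exists (in_tuple s). Qed.

Section TcommIdeal.
Variable m : nat.
Let idT := ideal_Tcomm A m.
Lemma Tcomm0 : Tcomm m (0 : A). Proof. exact: (ideal0 idT). Qed.
Lemma TcommD u v : Tcomm m u -> Tcomm m v -> Tcomm m (u + v).
Proof. exact: (idealD idT). Qed.
Lemma TcommB u v : Tcomm m u -> Tcomm m v -> Tcomm m (u - v).
Proof. exact: (idealB idT). Qed.
Lemma TcommZ (k : K) u : Tcomm m u -> Tcomm m (k *: u).
Proof. exact: (idealZ idT). Qed.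
Lemma TcommMr u a : Tcomm m u -> Tcomm m (u * a).
Proof. exact: (ideal_mulr idT). Qed.
End TcommIdeal.

Lemma Tcomm_min m (J : set A) : ideal J ->
  (forall s, size s = m -> J (lcomm s)) -> Tcomm m `<=` J.
Proof.
move=> idJ H u; apply; split=> // _ [t _ <-].
by apply: H; rewrite size_tuple.
Qed.

Lemma TcommS_min m (J : set A) : ideal J ->
  (forall s a, size s = m.+1 -> J (comm (lcomm s) a)) -> Tcomm m.+2 `<=` J.
Proof.
move=> idJ H; apply: Tcomm_min => // s; case/lastP: s => // s a.
rewrite size_rcons => -[sz]; rewrite lcomm_rcons; first exact: H.
by case: s sz.
Qed.

Lemma Tcomm1 u : Tcomm 1 u.
Proof. exact: (@Tcomm_lcomm [:: u]). Qed.

Lemma TcommSS_comm s a : (0 < size s)%N -> Tcomm (size s).+1 (comm (lcomm s) a).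
Proof.
move=> s0; rewrite -lcomm_rcons -?(size_rcons s a); last by case: s s0.
exact: Tcomm_lcomm.
Qed.

Lemma Tcomm_antitone m : Tcomm m.+2 `<=` (Tcomm m.+1 : set A).
Proof.
apply: TcommS_min => [|s a <-]; first exact: ideal_Tcomm.
apply: (ideal_comm (ideal_Tcomm _ _)); exact: Tcomm_lcomm.
Qed.

Lemma Tcomm_le m m' : (0 < m)%N -> (m <= m')%N -> Tcomm m' `<=` (Tcomm m : set A).
Proof.
case: m => // m _; elim: m' => // m' IH; rewrite leq_eqVlt => /orP[/eqP <- //|].
rewrite ltnS; case: m' IH => // m' IH lm; apply: subset_trans (IH lm).
exact: Tcomm_antitone.
Qed.

End CommutatorIdeals.

Lemma lcomm_morph (K : comNzRingType) (A B : algType K) (f : {lrmorphism A -> B})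
  (s : seq A) : f (lcomm s) = lcomm (map f s).
Proof.
case: s => [|a s] /=; first exact: rmorph0.
elim: s a => //= b s IH a; rewrite IH; congr (foldl _ _ _).
by rewrite /comm rmorphB !rmorphM.
Qed.

Lemma ideal_preimage (K : comNzRingType) (A B : algType K)
  (f : {lrmorphism A -> B}) (J : set B) : ideal J -> ideal [set u | J (f u)].
Proof.
move=> idJ; split=> [|u v Ju Jv|a u Ju|a u Ju] /=.
- by rewrite rmorph0; exact: ideal0.
- by rewrite rmorphD; exact: idealD.
- by rewrite rmorphM; exact: ideal_mull.
- by rewrite rmorphM; exact: ideal_mulr.
Qed.

Lemma Tcomm_morph (K : comNzRingType) (A B : algType K) (f : {lrmorphism A -> B})
  m u : Tcomm m u -> Tcomm m (f u).
Proof.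
move: u; apply: (Tcomm_min (ideal_preimage f (ideal_Tcomm B m))) => s <- /=.
by rewrite lcomm_morph -(size_map f s); exact: Tcomm_lcomm.
Qed.

(** Phrased as an induction principle, so that it can be applied directly to any property of the
    elements of [A]. *)
Definition generates (K : comNzRingType) (A : algType K) (x y : A) : Prop :=
  forall S : set A, S x -> S y -> (forall c : K, S c%:A) ->
    (forall u v, S u -> S v -> S (u + v)) ->
    (forall u v, S u -> S v -> S (u * v)) -> forall u, S u.

Section TwoGenerators.
Variables (K : fieldType) (A : algType K) (x y : A).
Hypothesis gen : generates x y.
Hypothesis two_neq0 : (2%:R : K) != 0.
Implicit Types (a b c d t u v : A).

Section Alternating.
Variables (J : set A) (u : A).
Hypothesis idJ : ideal J.
Hypothesis Ju : forall a b, J (comm (comm u a) b).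

(* Modulo [J], [f] is alternating and a derivation in each argument, so it
   vanishes because it has three arguments and there are two generators. *)
Let f a b c := comm u a * comm b c.

Let fC12 a b c : J (f a b c) -> J (f b a c).
Proof.
move=> Jf.
(* Leibniz expansion of [[[u, a b], c]]: all terms other than [f a b c + f b a c] lie in [J]. *)
have -> : f b a c = comm (comm u (a * b)) c + comm (comm u b) (comm a c)
   - (a * comm (comm u b) c) - comm (comm u a) c * b - f a b c.
  by rewrite /f; ncring.
apply: idealB => //; apply: idealB => //; last exact: ideal_mulr.
apply: idealB => //; last exact: ideal_mull.
by apply: idealD => //; exact: Ju.
Qed.

Let fC23 a b c : J (f a b c) -> J (f a c b).
Proof.
move=> Jf; have -> : f a c b = - f a b c by rewrite /f; ncring.
exact: idealN.
Qed.

Let fC13 a b c : J (f a b c) -> J (f c b a).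
Proof. by move=> /fC12/fC23/fC12. Qed.

Let fM a b c d : J (f a b c) -> J (f a b d) -> J (f a b (c * d)).
Proof.
move=> Jc Jd.
have -> : f a b (c * d) =
    c * f a b d + comm (comm u a) c * comm b d + f a b c * d.
  by rewrite /f; ncring.
apply: idealD => //; last exact: ideal_mulr.
by apply: idealD => //; [exact: ideal_mull|exact: ideal_mulr].
Qed.

Let fD a b c d : J (f a b c) -> J (f a b d) -> J (f a b (c + d)).
Proof. by move=> Jc Jd; rewrite /f commDr mulrDr; apply: idealD. Qed.

Let fA a b (k : K) : J (f a b k%:A).
Proof. by rewrite /f commA mulr0; exact: ideal0. Qed.

Let f_gen a b : J (f a b x) -> J (f a b y) -> forall c, J (f a b c).
Proof.
move=> fx fy; apply: (gen (S := fun c => J (f a b c))) => // *.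
  exact: fD.
exact: fM.
Qed.

Let fvv a c : J (f a a c).
Proof.
(* The same expansion with equal arguments only controls twice the element. *)
have -> : f a a c = 2%:R^-1 *: (f a a c + f a a c).
  by rewrite -mulr2n -scaler_nat scalerA mulVf // scale1r.
apply: idealZ => //.
have -> : f a a c + f a a c = comm (comm u (a * a)) c
   + comm (comm u a) (comm a c) - (a * comm (comm u a) c) - comm (comm u a) c * a.
  by rewrite /f; ncring.
apply: idealB => //; last exact: ideal_mulr.
apply: idealB => //; last exact: ideal_mull.
by apply: idealD => //; exact: Ju.
Qed.

Lemma comm_mul_comm a b c : J (comm u a * comm b c).
Proof.
suff : J (f a b c) by [].
(* Generators fill the slots one at a time; once two slots hold [x] and [y], reducing the third to a
   generator repeats an argument. *)
have fxy : forall c, J (f x y c).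
  by apply: f_gen; [apply: fC23; exact: fvv|rewrite /f commvv mulr0; exact: ideal0].
have fx : forall a c, J (f a x c).
  move=> a' c'; apply: fC12; apply: fC23; move: a'; apply: f_gen.
    by apply: fC23; exact: fvv.
  by apply: fC23; exact: fxy.
have fy : forall a c, J (f a y c).
  move=> a' c'; apply: fC12; apply: fC23; move: a'; apply: f_gen.
    by apply: fC13; apply: fC12; exact: fx.
  by apply: fC23; exact: fvv.
apply: fC23; move: b; apply: f_gen; apply: fC23; [exact: fx|exact: fy].
Qed.

End Alternating.

(** The [t] with this property for all [b], [c] form an ideal, because [a [b, c] = [a b, c] - [a, c]
    b]. This reduces the claim to left-normed commutators, where [comm_mul_comm] applies. *)
Lemma Tcomm_mul_comm m t b c : Tcomm m.+2 t -> Tcomm m.+3 (t * comm b c).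
Proof.
move=> Tt; move: b c; pose J := [set t | forall b c, Tcomm m.+3 (t * comm b c)].
have idT := ideal_Tcomm A m.+3.
suff : J t by [].
move: t Tt; apply: TcommS_min; last first.
  move=> s a sz b c; apply: (comm_mul_comm idT) => a' b'.
  rewrite -lcomm_rcons; last by case: s sz.
  have <- : size (rcons s a') = m.+2 by rewrite size_rcons sz.
  by apply: TcommSS_comm; rewrite size_rcons.
split=> [b c|t u Jt Ju b c|a t Jt b c|a t Jt b c].
- by rewrite mul0r; exact: (ideal0 idT).
- by rewrite mulrDl; apply: (idealD idT).
- by rewrite -mulrA; apply: (ideal_mull idT).
- have -> : t * a * comm b c = t * comm (a * b) c - t * comm a c * b by ncring.
  by apply: (idealB idT) => //; exact: (ideal_mulr idT).
Qed.

(** Again an ideal argument, with membership in T^(m) carried along: in [[a t, b] = a [t, b] + t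
    [a, b] - [t, [a, b]]] the middle term is handled by [Tcomm_mul_comm]. *)
Lemma Tcomm_comm m t a : (0 < m)%N -> Tcomm m t -> Tcomm m.+1 (comm t a).
Proof.
case: m => // -[|m] _ Tt; first exact: (@TcommSS_comm _ _ [:: t]).
move: a; pose J := [set t | Tcomm m.+2 t /\ forall b, Tcomm m.+3 (comm t b)].
have idT := ideal_Tcomm A m.+3; have idT' := ideal_Tcomm A m.+2.
suff : J t by case.
move: t Tt; apply: TcommS_min; last first.
  move=> s a sz.
  have e : comm (lcomm s) a = lcomm (rcons s a).
    by rewrite lcomm_rcons //; case: s sz.
  have sz' : size (rcons s a) = m.+2 by rewrite size_rcons sz.
  rewrite e; split=> [|b]; rewrite -sz'; first exact: Tcomm_lcomm.
  by apply: TcommSS_comm; rewrite sz'.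
split=> [|t u [Tt Jt] [Tu Ju]|a t [Tt Jt]|a t [Tt Jt]].
- split=> [|b]; first exact: (ideal0 idT').
  by rewrite /comm mul0r mulr0 subrr; exact: (ideal0 idT).
- split=> [|b]; first exact: (idealD idT').
  by rewrite commDl; apply: (idealD idT).
- split=> [|b]; first exact: (ideal_mull idT').
  have -> : comm (a * t) b = a * comm t b + t * comm a b - comm t (comm a b) by ncring.
  apply: (idealB idT) => //; apply: (idealD idT); first exact: (ideal_mull idT).
  exact: Tcomm_mul_comm.
- split=> [|b]; first exact: (ideal_mulr idT').
  rewrite commMl; apply: (idealD idT); last exact: (ideal_mulr idT).
  exact: Tcomm_mul_comm.
Qed.

End TwoGenerators.

(** * The filtration by degree in commutators *)

(* [proper_poly x y i j]: the span of the products of commutators in [x], [y] of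
   degree [i] in [x] and [j] in [y]. *)
Inductive proper_poly (K : comNzRingType) (A : algType K) (x y : A) :
    nat -> nat -> A -> Prop :=
  | proper_poly_xy : proper_poly x y 1 1 (comm x y)
  | proper_poly_commx i j c : proper_poly x y i j c -> proper_poly x y i.+1 j (comm c x)
  | proper_poly_commy i j c : proper_poly x y i j c -> proper_poly x y i j.+1 (comm c y)
  | proper_polyM i j k l c c' : proper_poly x y i j c -> proper_poly x y k l c' ->
      proper_poly x y (i + k) (j + l) (c * c')
  | proper_poly0 i j : proper_poly x y i j 0
  | proper_polyD i j c c' : proper_poly x y i j c -> proper_poly x y i j c' ->
      proper_poly x y i j (c + c')
  | proper_polyZ (k : K) i j c : proper_poly x y i j c -> proper_poly x y i j (k *: c).

(* The left span of the proper polynomials of degree at least [d]; everything if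
   [d <= 1].  It is a T-ideal, see [ideal_filt] and [filt_morph]. *)
Inductive filt (K : comNzRingType) (A : algType K) (x y : A) (d : nat) :
    A -> Prop :=
  | filt_low a : (d <= 1)%N -> filt x y d a
  | filt_zero : filt x y d 0
  | filt_add u v : filt x y d u -> filt x y d v -> filt x y d (u + v)
  | filt_mul a i j w : (d <= i + j)%N -> proper_poly x y i j w -> filt x y d (a * w).

Section Proper.
Variables (K : fieldType) (A : algType K) (x y : A).
Hypothesis gen : generates x y.
Implicit Types (a b c t u v w : A).

Local Notation W := (proper_poly x y).
Local Notation P := (filt x y).

Lemma proper_pos i j w : W i j w -> w = 0 \/ (0 < i)%N /\ (0 < j)%N.
Proof.
move=> Ww0; elim: i j w / Ww0 => [|i j c _ IH|i j c _ IH|i j k l c c' _ IH _ IH'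
  |i j|i j c c' _ IH _ IH'|k i j c _ IH]; try by [right|left].
- by case: IH => [->|[]]; [left; rewrite /comm mul0r mulr0 subrr|right].
- by case: IH => [->|[]]; [left; rewrite /comm mul0r mulr0 subrr|right].
- case: IH => [->|IH]; first by left; rewrite mul0r.
  case: IH' => [->|IH']; first by left; rewrite mulr0.
  by right; split; lia.
- by case: IH => [->|]; [rewrite add0r|right].
- by case: IH => [->|]; [left; rewrite scaler0|right].
Qed.

Section Degree.
Hypothesis two_neq0 : (2%:R : K) != 0.

(* Since [T^(m), A] lies in [T^(m+1)], commutation raises the [k] such that
   [T^(m) * u] lies in [T^(m+k)] for all [m]: [t [u, a] = [t u, a] - [t, a] u]. *)
Let shiftT k u := forall m t, (0 < m)%N -> Tcomm m t -> Tcomm (m + k) (t * u).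

Let shiftT_comm k u a : shiftT k u -> shiftT k.+1 (comm u a).
Proof.
move=> Su m t m0 Tt; rewrite addnS.
have -> : t * comm u a = comm (t * u) a - comm t a * u by ncring.
apply: TcommB.
  by apply: (Tcomm_comm gen) => //; [lia|exact: Su].
by rewrite -addSn; apply: Su => //; exact: (Tcomm_comm gen).
Qed.

Let shiftT_comm0 k u a : shiftT k u -> shiftT k (comm u a).
Proof.
move=> Su m t m0 Tt; have -> : t * comm u a = t * u * a - t * a * u by ncring.
apply: TcommB.
  by apply: TcommMr; exact: Su.
by apply: Su => //; exact: TcommMr.
Qed.

Let shiftT0 u : shiftT 0 u.
Proof. by move=> m t _ Tt; rewrite addn0; exact: TcommMr. Qed.

Let shiftTM k l u v : shiftT k u -> shiftT l v -> shiftT (k + l) (u * v).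
Proof.
move=> Su Sv m t m0 Tt; rewrite addnA mulrA; apply: Sv; first lia.
exact: Su.
Qed.

Let shiftT_proper i j w : W i j w -> shiftT i w /\ shiftT j w.
Proof.
move=> Ww0; elim: i j w / Ww0 => [|i j c _ [IH IH']|i j c _ [IH IH']
   |i j k l c c' _ [IHi IHj] _ [IHk IHl]
   |i j|i j c c' _ [IH IH'] _ [IHc IHc']|k i j c _ [IH IH']].
- by split; apply: shiftT_comm; exact: shiftT0.
- by split; [exact: shiftT_comm|exact: shiftT_comm0].
- by split; [exact: shiftT_comm0|exact: shiftT_comm].
- by split; exact: shiftTM.
- by split=> m t m0 Tt; rewrite mulr0; exact: Tcomm0.
- by split=> m t m0 Tt; rewrite mulrDr; apply: TcommD;
    auto.
- by split=> m t m0 Tt; rewrite -scalerAr; apply: TcommZ;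
    auto.
Qed.

Lemma proper_Tcomm i j w : W i j w -> Tcomm i.+1 w /\ Tcomm j.+1 w.
Proof.
move=> /shiftT_proper[Si Sj]; rewrite -[w]mul1r.
by split; rewrite -add1n; [apply: Si|apply: Sj] => //; exact: Tcomm1.
Qed.

Variable n : nat.
Hypothesis nil : Tcomm n `<=` [set 0 : A].

Lemma proper_eq0 i j w : (0 < n)%N -> W i j w ->
  (n <= i.+1)%N \/ (n <= j.+1)%N -> w = 0.
Proof.
move=> n0 /proper_Tcomm[Ti Tj] [ni|nj]; apply: nil.
  by apply: Tcomm_le Ti.
by apply: Tcomm_le Tj.
Qed.

(** If [i + j] is at least [2n - 3], one of [i], [j] is at least [n - 1], and [proper_eq0]
    applies. *)
Lemma filt_eq0 d u : (2 < n)%N -> (n + n <= d + 3)%N -> P d u -> u = 0.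
Proof.
move=> n1 nd Pu0; elim: u / Pu0 => [a d1| |u v _ -> _ ->|a i j w dij Ww] //.
- lia.
- by rewrite addr0.
- by rewrite (proper_eq0 _ Ww) ?mulr0 //; lia.
Qed.

End Degree.

Lemma filt_le d d' u : (d <= d')%N -> P d' u -> P d u.
Proof.
move=> dd' Pu0; elim: u / Pu0 => [a d1| |u v _ Pu _ Pv|a i j w dij Ww].
- by apply: filt_low; lia.
- exact: filt_zero.
- exact: filt_add.
- by apply: (filt_mul _ _ Ww); lia.
Qed.

Lemma filt_proper i j w : W i j w -> P (i + j) w.
Proof. by move=> Ww; rewrite -[w]mul1r; apply: filt_mul Ww. Qed.

Let filtMl d a u : P d u -> P d (a * u).
Proof.
move=> Pu0; elim: u / Pu0 => [b d1| |u v _ Pu _ Pv|b i j w dij Ww].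
- exact: filt_low.
- by rewrite mulr0; exact: filt_zero.
- by rewrite mulrDr; exact: filt_add.
- by rewrite mulrA; exact: (filt_mul _ _ Ww).
Qed.

(** Moving a generator [z] to the left of [w] costs [[w, z]], which is proper of one degree more;
    [gen] extends this to all right factors. *)
Let filtMr d b u : P d u -> P d (u * b).
Proof.
move: d b u; have filtMx z : (forall i j w, W i j w -> P (i + j) (comm w z)) ->
    forall d u, P d u -> P d (u * z).
  move=> Hz d u Pu0; elim: u / Pu0 => [b d1| |u v _ Pu _ Pv|b i j w dij Ww].
  - exact: filt_low.
  - by rewrite mul0r; exact: filt_zero.
  - by rewrite mulrDl; exact: filt_add.
  - have -> : b * w * z = b * z * w + b * comm w z by ncring.
    apply: filt_add; first exact: (filt_mul _ _ Ww).
    by apply: filtMl; apply: (filt_le dij); exact: Hz.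
suff H : forall b d u, P d u -> P d (u * b) by move=> d b u; exact: H.
apply: gen.
- apply: filtMx => i j w Ww; apply: (filt_le (leqnSn _)).
  by rewrite -addSn; apply: filt_proper; exact: proper_poly_commx.
- apply: filtMx => i j w Ww; apply: (filt_le (leqnSn _)).
  by rewrite -addnS; apply: filt_proper; exact: proper_poly_commy.
- by move=> k d u Pu; rewrite -scalerAr mulr1 -[u]mul1r scalerAl; exact: filtMl.
- by move=> b b' Hb Hb' d u Pu; rewrite mulrDr; apply: filt_add; auto.
- by move=> b b' Hb Hb' d u Pu; rewrite mulrA; auto.
Qed.

Lemma ideal_filt d : ideal (P d).
Proof.
by split; [exact: filt_zero|move=> u v; exact: filt_add|exact: filtMl
  |move=> b u; exact: filtMr].
Qed.

(** The coefficient of [v] is absorbed into [u] from the right. Degrees up to 1 are excluded because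
    [filt] is then all of [A]. *)
Lemma filtM d e u v : (1 < d)%N -> (1 < e)%N -> P d u -> P e v -> P (d + e) (u * v).
Proof.
move=> d1 e1 Pu Pv0; elim: v / Pv0 => [b|  |v v' _ Pv _ Pv'|b k l w' ekl Ww'].
- lia.
- by rewrite mulr0; exact: filt_zero.
- by rewrite mulrDr; exact: filt_add.
rewrite mulrA; have := filtMr b Pu; move: (u * b) => {}u {}Pu.
elim: u / Pu => [a| |u u' _ Pu _ Pu'|a i j w dij Ww].
- lia.
- by rewrite mul0r; exact: filt_zero.
- by rewrite mulrDl; exact: filt_add.
- rewrite -mulrA; apply: filt_mul (proper_polyM Ww Ww'); lia.
Qed.

Lemma filt_comm_proper i j w a : W i j w -> P (i + j).+1 (comm w a).
Proof.
move=> Ww; move: a; apply: gen.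
- by rewrite -addSn; apply: filt_proper; exact: proper_poly_commx.
- by rewrite -addnS; apply: filt_proper; exact: proper_poly_commy.
- by move=> k; rewrite commA; exact: filt_zero.
- by move=> u v Pu Pv; rewrite commDr; exact: filt_add.
- by move=> u v Pu Pv; rewrite commMr; apply: filt_add; [exact: filtMl|exact: filtMr].
Qed.

Lemma filt_comm2 a b : P 2 (comm a b).
Proof.
have Px z : P 2 (comm z x) -> P 2 (comm z y) -> forall b, P 2 (comm z b).
  move=> Pzx Pzy; apply: gen => //.
  - by move=> k; rewrite commA; exact: filt_zero.
  - by move=> u v Pu Pv; rewrite commDr; exact: filt_add.
  - by move=> u v Pu Pv; rewrite commMr; apply: filt_add; [exact: filtMl|exact: filtMr].
have Pxy : P 2 (comm x y) by exact: (filt_proper (proper_poly_xy x y)).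
have PC u v : P 2 (comm u v) -> P 2 (comm v u).
  by move=> ?; rewrite commN; exact: (idealN (ideal_filt 2)).
have P0 z : P 2 (comm z z) by rewrite commvv; exact: filt_zero.
by apply: (Px a); apply: (PC); apply: (Px _) => //; exact: (PC).
Qed.

Lemma filt_comm d u a : P d u -> P d.+1 (comm u a).
Proof.
move=> Pu0; elim: u / Pu0 => [b d1| |u v _ Pu _ Pv|b i j w dij Ww].
- by apply: (@filt_le _ 2) => //; exact: filt_comm2.
- by rewrite /comm mul0r mulr0 subrr; exact: filt_zero.
- by rewrite commDl; exact: filt_add.
rewrite commMl; apply: filt_add.
  by apply: filtMl; apply: (@filt_le _ (i + j).+1) => //; exact: filt_comm_proper.
have [->|[i0 j0]] := proper_pos Ww; first by rewrite mulr0; exact: filt_zero.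
apply: (@filt_le _ (2 + (i + j))); first by lia.
by apply: filtM; [|lia|exact: filt_comm2|exact: filt_proper].
Qed.

Lemma filt_commM d u a b : P d u -> P d.+1 (comm a b * u).
Proof.
move=> Pu; case: d Pu => [|[|d]] Pu; first exact: filt_low.
  by apply: filtMr; exact: filt_comm2.
apply: (@filt_le _ (2 + d.+2)); first by lia.
by apply: filtM => //; exact: filt_comm2.
Qed.

Lemma filt_commM2 d u a b : (1 < d)%N -> P d u -> P d.+2 (comm a b * u).
Proof. by move=> d1 Pu; rewrite -add2n; apply: filtM => //; exact: filt_comm2. Qed.

(** The image of a proper polynomial is the same bracket expression in other elements, and
    [filt_comm2], [filt_comm] and [filtM] bound its degree whatever these elements are. *)
Lemma filt_morph d (f : {lrmorphism A -> A}) u : P d u -> P d (f u).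
Proof.
have fcomm a b : f (comm a b) = comm (f a) (f b) by rewrite /comm rmorphB !rmorphM.
have Wf i j w : W i j w -> P (i + j) (f w).
  move=> Ww0; elim: i j w / Ww0 => [|i j c _ IH|i j c _ IH|i j k l c c' Wc IH Wc' IH'
    |i j|i j c c' _ IH _ IH'|k i j c _ IH].
  - by rewrite fcomm; exact: filt_comm2.
  - by rewrite fcomm addSn; exact: filt_comm.
  - by rewrite fcomm addnS; exact: filt_comm.
  - have [->|[i0 j0]] := proper_pos Wc; first by rewrite mul0r rmorph0; exact: filt_zero.
    have [->|[k0 l0]] := proper_pos Wc'; first by rewrite mulr0 rmorph0; exact: filt_zero.
    rewrite rmorphM addnACA; apply: filtM => //; lia.
  - by rewrite rmorph0; exact: filt_zero.
  - by rewrite rmorphD; exact: filt_add.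
  - by rewrite linearZ; exact: (idealZ (ideal_filt _)).
move=> Pu0; elim: u / Pu0 => [b d1| |u v _ Pu _ Pv|b i j w dij Ww].
- exact: filt_low.
- by rewrite rmorph0; exact: filt_zero.
- by rewrite rmorphD; exact: filt_add.
- by rewrite rmorphM; apply: filtMl; apply: (filt_le dij); exact: Wf.
Qed.

Lemma Tspace_filt d : Tspace (P d).
Proof. by split; [exact: (ideal_subspace (ideal_filt d))|exact: filt_morph]. Qed.

Lemma Tcomm_filt m : Tcomm m `<=` P m.
Proof.
apply: Tcomm_min => [|s <-]; first exact: ideal_filt.
elim/last_ind: s => [|s a IH]; first exact: filt_zero.
case: s IH => [|b s] IH; first exact: filt_low.
by rewrite lcomm_rcons // size_rcons; exact: filt_comm.
Qed.

End Proper.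

(** * Derivations from one-parameter substitutions *)

Definition free_on (K : comNzRingType) (A : algType K) (x y : A) : Prop :=
  forall f g : A, exists phi : {lrmorphism A -> A}, phi x = f /\ phi y = g.

Lemma subspace_sum (K : comNzRingType) (A : algType K) (U : set A) (I : Type)
    (r : seq I) (Q : pred I) (F : I -> A) :
  subspace U -> (forall i, Q i -> U (F i)) -> U (\sum_(i <- r | Q i) F i).
Proof. by case=> U0 UD _ UF; elim/big_ind: _. Qed.

Lemma subspaceN (K : comNzRingType) (A : algType K) (U : set A) u :
  subspace U -> U u -> U (- u).
Proof. by case=> _ _ UZ Uu; rewrite -scaleN1r; exact: UZ. Qed.

Lemma subspaceB (K : comNzRingType) (A : algType K) (U : set A) u v :
  subspace U -> U u -> U v -> U (u - v).
Proof. by move=> sU Uu Uv; case: (sU) => _ + _; apply=> //; exact: subspaceN. Qed.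

(** At [N] distinct scalars the Vandermonde matrix is invertible, and its inverse expresses each
    coefficient as a linear combination of values. *)
Lemma vandermonde_coef (K : fieldType) (A : algType K) (U : set A) (N : nat)
    (c : 'I_N -> A) : infinite_set [set: K] -> subspace U ->
  (forall s : K, U (\sum_(i < N) s ^+ i *: c i)) -> forall i, U (c i).
Proof.
move=> infK sU H j.
have [B _ NB] := infinite_set_fset N infK.
pose a : 'rV[K]_N := \row_i nth 0 (enum_fset B) i.
pose V := Vandermonde N a.
have Vunit : V \in unitmx.
  rewrite unitmxE det_Vandermonde unitfE.
  apply/prodf_neq0 => i _; apply/prodf_neq0 => k ik.
  rewrite !mxE subr_eq0 nth_uniq ?fset_uniq //.
  - by rewrite eq_sym (ltn_eqF ik).
  - by apply: leq_trans NB; exact: ltn_ord.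
  - by apply: leq_trans NB; exact: ltn_ord.
have -> : c j = \sum_k invmx V k j *: \sum_(i < N) a 0 k ^+ i *: c i.
  transitivity (\sum_(i < N) (i == j)%:R *: c i).
    rewrite (bigD1 j) //= eqxx scale1r big1 ?addr0 // => i /negPf ->.
    by rewrite scale0r.
  under [RHS]eq_bigr do rewrite scaler_sumr.
  rewrite exchange_big /=; apply: eq_bigr => i _.
  under eq_bigr do rewrite scalerA.
  rewrite -scaler_suml; congr (_ *: _).
  have /matrixP/(_ i j) := mulmxV Vunit; rewrite !mxE => <-.
  by apply: eq_bigr => k _; rewrite !mxE mulrC.
apply: subspace_sum => // k _.
by case: (sU) => _ _; apply; exact: H.
Qed.

(** [D f g] is the derivation sending [x] to [f] and [y] to [g]. The last clause is what makes it a
    tool for T-spaces. *)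
Definition der_spec (K : comNzRingType) (A : algType K) (x y : A)
    (D : A -> A -> A -> A) : Prop :=
  forall f g,
  [/\ forall u v, D f g (u + v) = D f g u + D f g v,
      forall (c : K) u, D f g (c *: u) = c *: D f g u,
      forall u v, D f g (u * v) = D f g u * v + u * D f g v,
      D f g x = f /\ D f g y = g
    & forall U u, Tspace U -> U u -> U (D f g u)].

Section Derivations.
Variables (K : fieldType) (A : algType K) (x y : A).
Hypothesis gen : generates x y.
Hypothesis free : free_on x y.
Hypothesis infK : infinite_set [set: K].

Section Fixed.
Variables f g : A.

(** The Taylor expansion of [u] in [s], as a polynomial over [A] evaluated at the central elements
    [s%:A]. *)
Definition expansion (u : A) (q : {poly A}) : Prop :=
  q`_0 = u /\ forall (s : K) (phi : {lrmorphism A -> A}),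
    phi x = x + s *: f -> phi y = y + s *: g -> phi u = q.[s%:A].

Let commA_ q (s : K) : comm_poly q (s%:A : A).
Proof.
by rewrite /comm_poly -scalerAl -scalerAr mul1r mulr1.
Qed.

Lemma horner_scalar (q : {poly A}) (s : K) :
  q.[s%:A] = \sum_(i < size q) s ^+ i *: q`_i.
Proof.
rewrite horner_coef; apply: eq_bigr => i _.
by rewrite -[(s%:A : A) ^+ i]/(_ ^+ i) exprZn expr1n -scalerAr mulr1.
Qed.

Lemma expansion_ex u : exists q, expansion u q.
Proof.
move: u; apply: gen.
- exists (x%:P + f%:P * 'X); split; first by rewrite coefD coefC coefMX addr0.
  by move=> s phi -> _; rewrite hornerD hornerC hornerMX hornerC -scalerAr mulr1.
- exists (y%:P + g%:P * 'X); split; first by rewrite coefD coefC coefMX addr0.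
  by move=> s phi _ ->; rewrite hornerD hornerC hornerMX hornerC -scalerAr mulr1.
- move=> k; exists (k%:A)%:P; split; first by rewrite coefC.
  by move=> s phi _ _; rewrite hornerC linearZ rmorph1.
- move=> u v [p [p0 Hp]] [q [q0 Hq]]; exists (p + q); split.
    by rewrite coefD p0 q0.
  by move=> s phi px py; rewrite rmorphD /= (Hp s) // (Hq s) // hornerD.
- move=> u v [p [p0 Hp]] [q [q0 Hq]]; exists (p * q); split.
    by rewrite coef0M p0 q0.
  by move=> s phi px py; rewrite rmorphM /= (Hp s) // (Hq s) // hornerM_comm.
Qed.

Lemma expansion_coef U u q i :
  Tspace U -> U u -> expansion u q -> U q`_i.
Proof.
move=> [sU TU] Uu [_ Hq].
have [iq|iq] := ltnP i (size q); last by rewrite nth_default //; case: sU.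
apply: (@vandermonde_coef _ _ _ (size q) (fun i => q`_i) infK sU _ (Ordinal iq)).
move=> s; have [phi [px py]] := free (x + s *: f) (y + s *: g).
by rewrite -horner_scalar -(Hq s phi px py); exact: TU.
Qed.

(** The difference vanishes at every scalar, so [vandermonde_coef] with the zero subspace kills its
    coefficients. *)
Lemma expansion_uniq u q q' : expansion u q -> expansion u q' -> q = q'.
Proof.
move=> [_ Hq] [_ Hq']; apply/polyP => i; apply/eqP; rewrite -subr_eq0 -coefB.
have [iq|iq] := ltnP i (size (q - q')); last by rewrite nth_default.
have s0 : subspace [set 0 : A].
  by split=> // [u' v -> ->|c u' ->]; rewrite ?addr0 ?scaler0.
apply/eqP.
apply: (@vandermonde_coef _ _ _ _ (fun i => (q - q')`_i) infK s0 _ (Ordinal iq)).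
move=> s; have [phi [px py]] := free (x + s *: f) (y + s *: g).
by rewrite -horner_scalar hornerD hornerN -(Hq s phi) // -(Hq' s phi) // subrr.
Qed.

End Fixed.

Lemma der_ex : exists D, der_spec x y D.
Proof.
pose E f g u := projT1 (cid (expansion_ex f g u)).
have EP f g u : expansion f g u (E f g u) by exact: projT2.
(* The derivative is the coefficient of [s]; each rule follows by exhibiting an explicit expansion
   and using uniqueness. *)
exists (fun f g u => (E f g u)`_1) => f g.
have EQ u q : expansion f g u q -> E f g u = q by apply: expansion_uniq.
split.
- move=> u v; rewrite (EQ _ (E f g u + E f g v)) ?coefD //.
  have [p0 Hp] := EP f g u; have [q0 Hq] := EP f g v.
  split; first by rewrite coefD p0 q0.
  by move=> s phi px py; rewrite rmorphD /= (Hp s) // (Hq s) // hornerD.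
- move=> c u; rewrite (EQ _ (c%:A *: E f g u)).
    by rewrite coefZ -scalerAl mul1r.
  have [p0 Hp] := EP f g u; split; first by rewrite coefZ p0 -scalerAl mul1r.
  by move=> s phi px py; rewrite linearZ /= (Hp s) // hornerZ -scalerAl mul1r.
- move=> u v; have [p0 Hp] := EP f g u; have [q0 Hq] := EP f g v.
  rewrite (EQ _ (E f g u * E f g v)).
    by rewrite coefM !big_ord_recl big_ord0 /= addr0 p0 q0 addrC.
  split; first by rewrite coef0M p0 q0.
  move=> s phi px py; rewrite rmorphM /= (Hp s) // (Hq s) // hornerM_comm //.
  by rewrite /comm_poly -scalerAl -scalerAr mul1r mulr1.
- split.
    rewrite (EQ _ (x%:P + f%:P * 'X)); first by rewrite coefD coefC coefMX coefC add0r.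
    split; first by rewrite coefD coefC coefMX addr0.
    by move=> s phi -> _; rewrite hornerD hornerC hornerMX hornerC -scalerAr mulr1.
  rewrite (EQ _ (y%:P + g%:P * 'X)); first by rewrite coefD coefC coefMX coefC add0r.
  split; first by rewrite coefD coefC coefMX addr0.
  by move=> s phi _ ->; rewrite hornerD hornerC hornerMX hornerC -scalerAr mulr1.
- by move=> U u TU Uu; apply: (expansion_coef 1 TU Uu).
Qed.

End Derivations.

(** * Polynomial vector fields modulo the filtration *)

Definition mon (K : comNzRingType) (A : algType K) (x y : A) (a b : nat) : A :=
  x ^+ a * y ^+ b.

Section VectorFields.
Variables (K : fieldType) (A : algType K) (x y : A).
Hypothesis gen : generates x y.
Variable D : A -> A -> A -> A.
Hypothesis Dspec : der_spec x y D.
Implicit Types (a b i j : nat) (f g h c u v w : A).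

Local Notation W := (proper_poly x y).
Local Notation P := (filt x y).
Local Notation mon := (mon x y).

Lemma derD f g u v : D f g (u + v) = D f g u + D f g v.
Proof. by have [] := Dspec f g. Qed.
Lemma derZ f g (k : K) u : D f g (k *: u) = k *: D f g u.
Proof. by have [] := Dspec f g. Qed.
Lemma derM f g u v : D f g (u * v) = D f g u * v + u * D f g v.
Proof. by have [] := Dspec f g. Qed.
Lemma derx f g : D f g x = f. Proof. by have [_ _ _ []] := Dspec f g. Qed.
Lemma dery f g : D f g y = g. Proof. by have [_ _ _ []] := Dspec f g. Qed.
Lemma der_Tspace U f g u : Tspace U -> U u -> U (D f g u).
Proof. by have [_ _ _ _] := Dspec f g; apply. Qed.
Lemma der0 f g : D f g 0 = 0.
Proof. by rewrite -(scale0r 0) derZ !scale0r. Qed.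
Lemma derN f g u : D f g (- u) = - D f g u.
Proof. by rewrite -!scaleN1r derZ. Qed.
Lemma der_comm f g u v : D f g (comm u v) = comm (D f g u) v + comm u (D f g v).
Proof. by rewrite /comm derD derN !derM; ncring. Qed.
Lemma der1 f g : D f g 1 = 0.
Proof.
have := derM f g 1 1; rewrite !mulr1 mul1r => /(congr1 (fun t => t - D f g 1)).
by rewrite addrK subrr.
Qed.
Lemma filt_der d f g u : P d u -> P d (D f g u).
Proof. by apply: der_Tspace; exact: (Tspace_filt gen). Qed.

(** [H] is an arbitrary derivation, so that this covers the Euler fields [D x 0], [D 0 y] and also
    the bracket of [D 0 x] and [D y 0]. *)
Lemma proper_weight (H : A -> A) (al be : K) :
  (forall u v, H (u + v) = H u + H v) -> (forall k u, H (k *: u) = k *: H u) ->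
  (forall u v, H (u * v) = H u * v + u * H v) ->
  H x = al *: x -> H y = be *: y ->
  forall i j w, W i j w -> H w = (i%:R * al + j%:R * be) *: w.
Proof.
move=> HD HZ HM Hx Hy i j w Ww.
have HN u : H (- u) = - H u by rewrite -!scaleN1r HZ.
have HC u v : H (comm u v) = comm (H u) v + comm u (H v).
  by rewrite /comm HD HN !HM; ncring.
elim: i j w / Ww => [|i j c _ IH|i j c _ IH|i j k l c c' _ IH _ IH'
  |i j|i j c c' _ IH _ IH'|k i j c _ IH].
- by rewrite HC Hx Hy commZl commZr -scalerDl !mul1r.
- by rewrite HC IH Hx commZl commZr -scalerDl; congr (_ *: _); ring.
- by rewrite HC IH Hy commZl commZr -scalerDl; congr (_ *: _); ring.
- by rewrite HM IH IH' -scalerAl -scalerAr -scalerDl; congr (_ *: _); ring.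
- by rewrite scaler0 -(scale0r 0) HZ !scale0r.
- by rewrite HD IH IH' scalerDr.
- by rewrite HZ IH !scalerA mulrC.
Qed.

Lemma der_xx i j w : W i j w -> D x 0 w = i%:R *: w.
Proof.
move/(@proper_weight (D x 0) 1 0); rewrite mulr1 mulr0 addr0; apply.
- exact: derD. - exact: derZ. - exact: derM.
- by rewrite derx scale1r.
- by rewrite dery scale0r.
Qed.

Lemma der_yy i j w : W i j w -> D 0 y w = j%:R *: w.
Proof.
move/(@proper_weight (D 0 y) 0 1); rewrite mulr1 mulr0 add0r; apply.
- exact: derD. - exact: derZ. - exact: derM.
- by rewrite derx scale0r.
- by rewrite dery scale1r.
Qed.

(** The sl_2 relation: the bracket of the two operators has weight 1 on [x] and -1 on [y]. *)
Lemma der_bracket i j w : W i j w ->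
  D 0 x (D y 0 w) = D y 0 (D 0 x w) + (i%:R - j%:R) *: w.
Proof.
move/(@proper_weight (fun w => D 0 x (D y 0 w) - D y 0 (D 0 x w)) 1 (-1)).
rewrite mulr1 mulrN1 => <- //.
- by rewrite addrC subrK.
- by move=> u v; rewrite !derD; ncring.
- by move=> k u; rewrite !derZ -scalerBr.
- by move=> u v; rewrite !(derM, derD); ncring.
- by rewrite !(derx, dery) der0 subr0 scale1r.
- by rewrite !(derx, dery) der0 sub0r scaleN1r.
Qed.

(** The operator turns one [x] into [y]. The truncation in [i.-1] is harmless: by [proper_pos],
    nonzero proper polynomials have positive partial degrees. *)
Lemma proper_der_yx i j w : W i j w -> W i.-1 j.+1 (D y 0 w).
Proof.
move=> Ww; elim: i j w / Ww => [|i j c Wc IH|i j c _ IH|i j k l c c' Wc IH Wc' IH'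
  |i j|i j c c' _ IH _ IH'|k i j c _ IH].
- rewrite der_comm derx dery commvv /comm mulr0 mul0r subrr addr0.
  exact: proper_poly0.
- rewrite der_comm derx.
  have [->|[i0 _]] := proper_pos Wc.
    by rewrite der0 /comm !mul0r !mulr0 subrr addr0; exact: proper_poly0.
  apply: proper_polyD; last exact: proper_poly_commy.
  by rewrite -[X in W X _ _](prednK i0); exact: proper_poly_commx.
- rewrite der_comm dery /comm mulr0 mul0r subrr addr0; exact: proper_poly_commy.
- have [->|[i0 _]] := proper_pos Wc; first by rewrite mul0r der0; exact: proper_poly0.
  have [->|[k0 _]] := proper_pos Wc'; first by rewrite mulr0 der0; exact: proper_poly0.
  rewrite derM; apply: proper_polyD.
    have -> : (i + k).-1 = (i.-1 + k)%N by lia.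
    by rewrite -addSn; exact: proper_polyM.
  have -> : (i + k).-1 = (i + k.-1)%N by lia.
  by rewrite -addnS; exact: proper_polyM.
- by rewrite der0; exact: proper_poly0.
- by rewrite derD; exact: proper_polyD.
- by rewrite derZ; exact: proper_polyZ.
Qed.

Lemma proper_der_xy i j w : W i j w -> W i.+1 j.-1 (D 0 x w).
Proof.
move=> Ww; elim: i j w / Ww => [|i j c _ IH|i j c Wc IH|i j k l c c' Wc IH Wc' IH'
  |i j|i j c c' _ IH _ IH'|k i j c _ IH].
- rewrite der_comm derx dery commvv /comm mulr0 mul0r subrr addr0.
  exact: proper_poly0.
- rewrite der_comm derx /comm mulr0 mul0r subrr addr0; exact: proper_poly_commx.
- rewrite der_comm dery.
  have [->|[_ j0]] := proper_pos Wc.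
    by rewrite der0 /comm !mul0r !mulr0 subrr addr0; exact: proper_poly0.
  apply: proper_polyD; last exact: proper_poly_commx.
  by rewrite -[X in W _ X _](prednK j0); exact: proper_poly_commy.
- have [->|[_ j0]] := proper_pos Wc; first by rewrite mul0r der0; exact: proper_poly0.
  have [->|[_ l0]] := proper_pos Wc'; first by rewrite mulr0 der0; exact: proper_poly0.
  rewrite derM; apply: proper_polyD.
    have -> : (j + l).-1 = (j.-1 + l)%N by lia.
    by rewrite -addSn; exact: proper_polyM.
  have -> : (j + l).-1 = (j + l.-1)%N by lia.
  by rewrite -addnS; exact: proper_polyM.
- by rewrite der0; exact: proper_poly0.
- by rewrite derD; exact: proper_polyD.
- by rewrite derZ; exact: proper_polyZ.
Qed.

(* [hx] and [hy] represent the partial derivatives of [h] modulo [P 2]. *)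
Definition grad (h hx hy : A) : Prop := forall k c, (0 < k)%N -> P k c ->
  P k.+2 (comm c h - hx * comm c x - hy * comm c y).

Local Notation PD := (idealD (ideal_filt gen _)).
Local Notation PB := (idealB (ideal_filt gen _)).
Local Notation PN := (idealN (ideal_filt gen _)).
Local Notation PMl := (ideal_mull (ideal_filt gen _)).
Local Notation PMr := (ideal_mulr (ideal_filt gen _)).
Local Notation PZ := (idealZ (ideal_filt gen _)).

Lemma grad_x : grad x 1 0.
Proof. by move=> k c _ _; rewrite mul1r subrr mul0r subrr; exact: filt_zero. Qed.

Lemma grad_y : grad y 0 1.
Proof. by move=> k c _ _; rewrite mul1r mul0r subr0 subrr; exact: filt_zero. Qed.

Lemma grad_1 : grad 1 0 0.
Proof.
move=> k c _ _; rewrite !mul0r !subr0 /comm mul1r mulr1 subrr; exact: filt_zero.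
Qed.

Lemma grad_M h hx hy g gx gy : grad h hx hy -> grad g gx gy ->
  grad (h * g) (h * gx + hx * g) (h * gy + hy * g).
Proof.
move=> Gh Gg k c k0 Pc; have := Gh k c k0 Pc; have := Gg k c k0 Pc.
set rg := (X in P _ X -> _); set rh := (X in _ -> P _ X -> _) => Pg Ph.
have -> : comm c (h * g) - (h * gx + hx * g) * comm c x
     - (h * gy + hy * g) * comm c y =
   h * rg + rh * g + (hx * comm (comm c x) g + hy * comm (comm c y) g).
  by rewrite /rg /rh; ncring.
apply: PD; first by apply: PD; [exact: PMl|exact: PMr].
by apply: PD; apply: PMl; do 2 apply: (filt_comm gen).
Qed.

Lemma grad_ext h hx hy hx' hy' : hx = hx' -> hy = hy' -> grad h hx hy -> grad h hx' hy'.
Proof. by move=> -> ->. Qed.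

Lemma grad_xX a : grad (x ^+ a) (a%:R *: x ^+ a.-1) 0.
Proof.
elim: a => [|a IH]; first by rewrite scale0r; exact: grad_1.
rewrite exprS; apply: grad_ext (grad_M grad_x IH); last by rewrite mulr0 mul0r addr0.
rewrite mul1r -scalerAr; case: a {IH} => [|a] /=.
  by rewrite scale0r add0r scale1r.
by rewrite -exprS [in RHS]mulrS scalerDl scale1r addrC.
Qed.

Lemma grad_yX b : grad (y ^+ b) 0 (b%:R *: y ^+ b.-1).
Proof.
elim: b => [|b IH]; first by rewrite scale0r; exact: grad_1.
rewrite exprS; apply: grad_ext (grad_M grad_y IH); first by rewrite mulr0 mul0r addr0.
rewrite mul1r -scalerAr; case: b {IH} => [|b] /=.
  by rewrite scale0r add0r scale1r.
by rewrite -exprS [in RHS]mulrS scalerDl scale1r addrC.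
Qed.

Lemma grad_mon a b : grad (mon a b) (a%:R *: mon a.-1 b) (b%:R *: mon a b.-1).
Proof.
apply: grad_ext (grad_M (grad_xX a) (grad_yX b)).
  by rewrite mulr0 add0r scalerAl.
by rewrite mul0r addr0 -scalerAr.
Qed.

Lemma grad_0 : grad 0 0 0.
Proof.
move=> k c _ _; rewrite !mul0r !subr0 /comm mul0r mulr0 subrr; exact: filt_zero.
Qed.

Lemma filt_eqmul d (u v : A) w : (1 < d)%N -> P 2 (u - v) -> P d w ->
  P d.+1 (u * w - v * w).
Proof.
move=> d1 Puv Pw; rewrite -mulrBl; apply: (@filt_le _ _ _ _ _ (2 + d)); first lia.
exact: (filtM gen).
Qed.

(** To leading order only the Jacobian matrix of [(h, g)] acts: its entries are coefficients, and
    [D x 0], [D y 0], [D 0 x], [D 0 y] are the matrix units of gl_2. *)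
Lemma der_proper h hx hy g gx gy i j w : grad h hx hy -> grad g gx gy -> W i j w ->
  P (i + j).+1 (D h g w - (hx * D x 0 w + hy * D y 0 w + gx * D 0 x w + gy * D 0 y w)).
Proof.
move=> Gh Gg Ww.
pose E w := hx * D x 0 w + hy * D y 0 w + gx * D 0 x w + gy * D 0 y w.
suff : P (i + j).+1 (D h g w - E w) by [].
(* A bracket with [z] passes through the coefficients of [E], since bracketing a coefficient instead
   yields a term of degree two more. *)
have commE k c z : (1 < k)%N -> P k c ->
    P k.+2 (comm (E c) z - (hx * comm (D x 0 c) z + hy * comm (D y 0 c) z
       + gx * comm (D 0 x c) z + gy * comm (D 0 y c) z)).
  move=> k1 Pc.
  set R := (X in P _ X).
  have -> : R = comm hx z * D x 0 c + comm hy z * D y 0 c + comm gx z * D 0 x c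
     + comm gy z * D 0 y c by rewrite /R /E; ncring.
  by do 3 ?apply: PD; apply: (filt_commM2 gen) => //; exact: filt_der.
elim: i j w / Ww => [|i j c Wc IH|i j c Wc IH|i j k l c c' Wc IH Wc' IH'
  |i j|i j c c' _ IH _ IH'|k i j c _ IH].
(* [D h g [x, y] = [h, y] + [x, g]], so [grad] is used at degree 1, where [P 1] is everything. *)
- have Py : P 1 y by exact: filt_low.
  have Px : P 1 x by exact: filt_low.
  have /PN Hh := Gh 1%N y isT Py; have Hg := Gg 1%N x isT Px.
  have := PD Hh Hg; rewrite /E !der_comm !derx !dery /=.
  by congr P; ncring.
- have [->|[i0 j0]] := proper_pos Wc.
    by rewrite /E /comm mul0r mulr0 subrr !der0 !mulr0 !addr0 subrr; exact: filt_zero.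
  have k1 : (1 < i + j)%N by lia.
  have Pc := filt_proper Wc.
  have H1 := commE _ _ x k1 Pc; have H2 := Gh _ _ (ltnW k1) Pc.
  have H3 := filt_comm gen x IH.
  have := PD (PD H1 H2) H3; rewrite addSn /E !der_comm !derx.
  by congr P; ncring.
- have [->|[i0 j0]] := proper_pos Wc.
    by rewrite /E /comm mul0r mulr0 subrr !der0 !mulr0 !addr0 subrr; exact: filt_zero.
  have k1 : (1 < i + j)%N by lia.
  have Pc := filt_proper Wc.
  have H1 := commE _ _ y k1 Pc; have H2 := Gg _ _ (ltnW k1) Pc.
  have H3 := filt_comm gen y IH.
  have := PD (PD H1 H2) H3; rewrite addnS /E !der_comm !dery.
  by congr P; ncring.
- have [->|[i0 j0]] := proper_pos Wc.
    by rewrite /E mul0r !der0 !mulr0 !addr0 subrr; exact: filt_zero.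
  have [->|[k0 l0]] := proper_pos Wc'.
    by rewrite /E mulr0 !der0 !mulr0 !addr0 subrr; exact: filt_zero.
  rewrite addnACA.
  have Pc := filt_proper Wc; have Pc' := filt_proper Wc'.
  have H1 : P (i + j + (k + l)).+1 ((D h g c - E c) * c').
    by rewrite -addSn; apply: (filtM gen) => //; lia.
  have H2 : P (i + j + (k + l)).+1 (c * (D h g c' - E c')).
    by rewrite -addnS; apply: (filtM gen) => //; lia.
  have H3 z F G : P (i + j + (k + l)).+1 (comm c z * D F G c').
    rewrite -addSn; apply: (filtM gen); [lia|lia|exact: (filt_comm gen)|].
    exact: filt_der.
  have := PD (PD H1 H2) (PD (PD (H3 hx x 0) (H3 hy y 0)) (PD (H3 gx 0 x) (H3 gy 0 y))).
  by rewrite /E !derM; congr P; ncring.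
- by rewrite /E !der0 !mulr0 !addr0 subrr; exact: filt_zero.
- have := PD IH IH'; rewrite /E !derD; congr P; ncring.
- have := PZ k IH; rewrite /E !derZ -!scalerAr !scalerBr !scalerDr.
  by congr P; rewrite !scalerAr.
Qed.

Lemma mon_mul d a b a' b' w : P d w ->
  P d.+1 (mon a b * (mon a' b' * w) - mon (a + a') (b + b') * w).
Proof.
move=> Pw.
have -> : mon a b * (mon a' b' * w) - mon (a + a') (b + b') * w =
   x ^+ a * (comm (y ^+ b) (x ^+ a') * (y ^+ b' * w)).
  by rewrite /mon !exprD; ncring.
by apply: PMl; apply: (filt_commM gen); exact: PMl.
Qed.

Lemma der_yx_mon a b : P 2 (D y 0 (mon a b) - a%:R *: mon a.-1 b.+1).
Proof.
have yX (c : nat) : D y 0 (y ^+ c) = 0.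
  elim: c => [|c IH]; first by rewrite der1.
  by rewrite exprS derM dery IH mul0r mulr0 addr0.
have xX (c : nat) : P 2 (D y 0 (x ^+ c) - (c%:R *: x ^+ c.-1) * y).
  elim: c => [|c IH]; first by rewrite der1 scale0r mul0r subrr; exact: filt_zero.
  rewrite exprS derM derx.
  have -> : c.+1%:R *: x ^+ c.+1.-1 = x ^+ c + x * (c%:R *: x ^+ c.-1).
    rewrite /= mulrS scalerDl scale1r; congr (_ + _); rewrite -scalerAr.
    by case: c {IH} => [|c] /=; rewrite ?scale0r // -exprS.
  have /PD := filt_comm2 gen y (x ^+ c) => /(_ _ (PMl x IH)).
  by congr P; ncring.
rewrite /mon derM yX mulr0 addr0 exprS mulrA scalerAl scalerAl -mulrBl.
exact: PMr.
Qed.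

End VectorFields.

(** * Multiplication by monomials inside a T-space *)

Section KeyLemma.
Variables (K : fieldType) (A : algType K) (x y : A).
Hypothesis gen : generates x y.
Variable D : A -> A -> A -> A.
Hypothesis Dspec : der_spec x y D.
Variables (p n : nat).
Hypothesis charK : p \in [pchar K].
Hypothesis n_le_p : (n <= p)%N.
Hypothesis p_gt3 : (3 < p)%N.
Hypothesis n_gt0 : (0 < n)%N.
Hypothesis nil : Tcomm n `<=` [set 0 : A].
Variables (d : nat) (U : set A).
Hypothesis d_gt2 : (2 < d)%N.
Hypothesis TU : Tspace U.
Hypothesis PU : filt x y d.+1 `<=` U.
Implicit Types (a b i j m : nat) (f g h c u v w : A).

Local Notation W := (proper_poly x y).
Local Notation P := (filt x y).
Local Notation M := (mon x y).

Let U0 : U 0. Proof. by case: TU => -[]. Qed.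
Let UD u v : U u -> U v -> U (u + v). Proof. by case: TU => -[_ + _] _; apply. Qed.
Let UZ (k : K) u : U u -> U (k *: u). Proof. by case: TU => -[_ _ +] _; apply. Qed.
Let UB u v : U u -> U v -> U (u - v).
Proof. by case: TU => sU _; exact: subspaceB. Qed.
Let UVZ (k : K) u : k != 0 -> U (k *: u) -> U u.
Proof. by move=> k0 Uu; rewrite -[u](scalerK k0); exact: UZ. Qed.
Let Ucongr u v : P d.+1 (u - v) -> U v -> U u.
Proof. by move=> Puv Uv; rewrite -[u](subrK v); apply: UD => //; exact: PU. Qed.
Let Ucongr' u v : P d.+1 (u - v) -> U u -> U v.
Proof.
move=> Puv; apply: Ucongr; rewrite -opprB; exact: (idealN (ideal_filt gen _)).
Qed.

Let natK_neq0 m : (0 < m)%N -> (m < p)%N -> (m%:R : K) != 0.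
Proof. by move=> m0 mp; rewrite -(dvdn_pcharf charK) gtnNdvd. Qed.

Let two_neq0 : (2%:R : K) != 0.
Proof. by apply: natK_neq0 => //; lia. Qed.

(** A nonzero [w] has [i + 1] and [j + 1] below [n], hence below [p], which keeps [i], [j], [i + 1]
    and [j + 1] nonzero in [K]. *)
Let proper_bound i j w : W i j w ->
  w = 0 \/ [/\ (0 < i)%N, (0 < j)%N, (i.+1 < n)%N & (j.+1 < n)%N].
Proof.
move=> Ww; have [->|[i0 j0]] := proper_pos Ww; first by left.
have [ni|ni] := leqP n i.+1.
  by left; apply: (proper_eq0 gen two_neq0 nil n_gt0 Ww); left.
have [nj|nj] := leqP n j.+1.
  by left; apply: (proper_eq0 gen two_neq0 nil n_gt0 Ww); right.
by right.
Qed.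

Let g0 : grad x y 0 0 0 := grad_0 (x := x) (y := y).

(** The vector field [x^a y^b d/dx] applied to [w]; [Udy] is its analogue for [d/dy]. *)
Let Udx i j w a b : (i + j = d)%N -> W i j w -> U w ->
  U ((a * i)%:R *: (M a.-1 b * w) + b%:R *: (M a b.-1 * D y 0 w)).
Proof.
move=> ijd Ww Uw; have := der_proper gen Dspec (grad_mon gen a b) g0 Ww.
rewrite ijd !mul0r !addr0 (der_xx Dspec Ww) -!scalerAl -scalerAr scalerA -natrM.
by move/Ucongr'; apply; exact: (der_Tspace Dspec).
Qed.

Let Udy i j w a b : (i + j = d)%N -> W i j w -> U w ->
  U (a%:R *: (M a.-1 b * D 0 x w) + (b * j)%:R *: (M a b.-1 * w)).
Proof.
move=> ijd Ww Uw; have := der_proper gen Dspec g0 (grad_mon gen a b) Ww.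
rewrite ijd !mul0r !add0r (der_yy Dspec Ww) -!scalerAl -scalerAr scalerA -natrM.
by move/Ucongr'; apply; exact: (der_Tspace Dspec).
Qed.

Let U_yx a b v : P d v -> U (M a b * v) ->
  U (a%:R *: (M a.-1 b.+1 * v) + M a b * D y 0 v).
Proof.
move=> Pv Uv; have := der_Tspace Dspec y 0 TU Uv; rewrite (derM Dspec).
apply: Ucongr'; rewrite [X in P _ X](_ : _ =
    D y 0 (M a b) * v - (a%:R *: M a.-1 b.+1) * v); last first.
  by rewrite -scalerAl; ncring.
by apply: (filt_eqmul gen) => //; [lia|exact: (der_yx_mon gen Dspec)].
Qed.

(* With [e = D 0 x] and [f = D y 0], the vector fields [x^(a+1) y^b d/dx] on [w]
   and [x^(a+1) y^b d/dy] on [f w] give [(a+1) x^a y^b (i (j+1) - e f) w] in [U].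
   As [e f = f e + i - j] and [x^a y^b f e w] is in [U] by induction, what remains
   is the multiple [(a+1) j (i+1)] of [x^a y^b w]. *)
Let mon_aux a b i j w : (i + j = d)%N -> W i j w -> U w ->
  (a.+1%:R : K) != 0 -> U (M a b * w).
Proof.
elim: j i w a b => [|j IH] i w a b ijd Ww Uw a1;
  have [->|[i0 j0 ni nj]] := proper_bound Ww; rewrite ?mulr0 //.
have Wf := proper_der_yx Dspec Ww; have We := proper_der_xy Dspec Ww.
have Uf : U (D y 0 w) by exact: (der_Tspace Dspec).
have Ue : U (D 0 x w) by exact: (der_Tspace Dspec).
have ijd' : (i.+1 + j = d)%N by lia.
have ijd'' : (i.-1 + j.+2 = d)%N by lia.
have X1 := Udx a.+1 b ijd Ww Uw; have X2 := Udy a.+1 b ijd'' Wf Uf.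
have Pe : P d (D 0 x w) by rewrite -ijd'; exact: filt_proper.
have X3 : U (M a b * D y 0 (D 0 x w)).
  have := U_yx Pe (IH _ _ a b ijd' We Ue a1).
  (* The extra term [a x^(a-1) y^(b+1) e w] vanishes if [a = 0] in [K]; otherwise the induction
     hypothesis applies at exponent [a - 1], whose condition is that [a] is nonzero. *)
  have [->|an0] := eqVneq (a%:R : K) 0; first by rewrite scale0r add0r.
  case: a {X1 X2 a1} an0 => [|a] an0; first by rewrite eqxx in an0.
  move=> H2; have := UB H2 (UZ a.+1%:R (IH _ _ a b.+1 ijd' We Ue an0)).
  by rewrite addrAC subrr add0r.
have c0 : (a.+1%:R * (j.+1%:R * i.+1%:R) : K) != 0.
  by rewrite mulf_neq0 // mulf_neq0 // natK_neq0 //; lia.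
apply: (UVZ c0).
have := UB (UB (UZ j.+2%:R X1) X2) (UZ (- a.+1%:R) X3).
rewrite (der_bracket Dspec Ww) /=; congr U.
rewrite mulrDr -scalerAr.
set t1 := M a b * w; set t2 := M a.+1 b.-1 * _; set t3 := M a b * _.
rewrite !scalerDr !scalerA scaleNr opprK.
have -> : (a.+1%:R * (j.+1%:R * i.+1%:R)) *: t1 = (j.+2%:R * (a.+1 * i)%:R) *: t1
   - (a.+1%:R * (i%:R - j.+1%:R)) *: t1.
  by rewrite -scalerBl; congr (_ *: _); ring.
have -> : (b * j.+2)%:R = j.+2%:R * b%:R :> K by rewrite natrM mulrC.
by ncring.
Qed.

(** [mon_aux] leaves the exponents [a] with [a = -1] in [K], where the divisor [a + 1] is lost;
    other vector fields replace the one used there. *)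
Lemma U_mon_mul a b i j w : (i + j = d)%N -> W i j w -> U w -> U (M a b * w).
Proof.
move=> ijd Ww Uw.
have [->|[i0 j0 ni nj]] := proper_bound Ww; first by rewrite mulr0.
have [a1|] := eqVneq (a.+1%:R : K) 0; last exact: (mon_aux b ijd Ww Uw).
have aE : a%:R = -1 :> K by apply/eqP; rewrite -addr_eq0 -natr1 in a1 *; rewrite a1.
have Wf := proper_der_yx Dspec Ww; have We := proper_der_xy Dspec Ww.
have Uf : U (D y 0 w) by exact: (der_Tspace Dspec).
have Ue : U (D 0 x w) by exact: (der_Tspace Dspec).
have ijd' : (i.+1 + j.-1 = d)%N by lia.
have ijd'' : (i.-1 + j.+1 = d)%N by lia.
have a_neq0 : a%:R != 0 :> K by rewrite aE oppr_eq0 oner_eq0.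
have a_gt0 : (0 < a)%N by case: a a_neq0 {aE a1} => //; rewrite eqxx.
have a_pred : (a.-1.+1%:R : K) != 0 by rewrite prednK.
have Pw : P d w by rewrite -ijd; exact: filt_proper.
have [b1|b1] := eqVneq (b.+1%:R : K) 0; last first.
  (* [x^a y^(b+1) d/dy] on [w] gives [(b+1) j x^a y^b w] up to a multiple of
     [x^(a-1) y^(b+1) (D 0 x w)], to which [mon_aux] applies as [a] is nonzero. *)
  have X1 := Udy a b.+1 ijd Ww Uw.
  have X2 := mon_aux b.+1 ijd' We Ue a_pred.
  have c0 : ((b.+1 * j)%:R : K) != 0.
    by rewrite natrM mulf_neq0 // natK_neq0 //; lia.
  apply: (UVZ c0); have := UB X1 (UZ a%:R X2).
  by rewrite addrAC subrr add0r.
have bE : b%:R = -1 :> K by apply/eqP; rewrite -addr_eq0 -natr1 in b1 *; rewrite b1.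
(* Now [a = b = -1] in [K]; the vector field [x^a y^b d/dx] on [x w] yields the
   factor [1 - i], and [x^a y^b d/dy] on [y w] yields [1 - j]. *)
have [i1|i1] := eqVneq i 1%N; last first.
  have Ux : U (M 1 0 * w) by apply: (mon_aux 0 ijd Ww Uw).
  have X1 := der_Tspace Dspec (M a b) 0 TU Ux.
  have X2 : U (M a.+1 b.-1 * D y 0 w).
    apply: (mon_aux _ ijd'' Wf Uf).
    by rewrite -natr1 a1 add0r oner_eq0.
  have X3 : U (M a b * w + (a * i)%:R *: (M a b * w)).
    have := UB X1 (UZ b%:R X2); apply: Ucongr'.
    have := der_proper gen Dspec (grad_mon gen a b) g0 Ww.
    rewrite ijd !mul0r !addr0 (der_xx Dspec Ww) -!scalerAl -scalerAr scalerA -natrM.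
    move/(ideal_mull (ideal_filt gen _) x); congr P.
    rewrite /mon expr1 expr0 mulr1 (derM Dspec) (derx Dspec) !mulrBr !mulrDr.
    rewrite -!scalerAr !mulrA -!exprS prednK //.
    by ncring.
  have c0 : (1 + (a * i)%:R : K) != 0.
    rewrite natrM aE mulN1r subr_eq0 eq_sym -subr_eq0.
    by rewrite -(natrB _ i0) natK_neq0 //; lia.
  by apply: (UVZ c0); rewrite scalerDl scale1r.
(* Now [i = 1], so [d > 2] forces [j > 1] and the factor [1 - j] is nonzero. *)
have Uy : U (M 0 1 * w) by apply: (mon_aux 1 ijd Ww Uw); rewrite oner_eq0.
have X1 := der_Tspace Dspec 0 (M a b) TU Uy.
have X2 : U (M a.-1 b.+1 * D 0 x w) by apply: (mon_aux _ ijd' We Ue).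
have X3 : U (M a b * w + (b * j)%:R *: (M a b * w)).
  have := UB X1 (UZ a%:R X2); apply: Ucongr'.
  have Pe : P d (D 0 x w) by rewrite -ijd'; exact: filt_proper.
  have b_gt0 : (0 < b)%N.
    by case: b bE {b1 X1 X2} => // /esym/eqP; rewrite oppr_eq0 oner_eq0.
  have H1 := mon_mul gen 0 1 a.-1 b Pe; have H2 := mon_mul gen 0 1 a b.-1 Pw.
  have H3 := der_proper gen Dspec g0 (grad_mon gen a b) Ww.
  move: H3; rewrite ijd !mul0r !add0r (der_yy Dspec Ww).
  move/(ideal_mull (ideal_filt gen _) y) => H3.
  have := idealD (ideal_filt gen _) (idealD (ideal_filt gen _) H3
     (idealZ (ideal_filt gen _) a%:R H1)) (idealZ (ideal_filt gen _) (b * j)%:R H2).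
  congr P; rewrite !add0n !add1n (prednK b_gt0).
  rewrite /mon expr1 expr0 mul1r (derM Dspec) (dery Dspec).
  rewrite -!scalerAl -!scalerAr scalerA -natrM !mulrBr !mulrDr -!scalerAr !scalerBr.
  by rewrite !mulrA; ncring.
have c0 : (1 + (b * j)%:R : K) != 0.
  rewrite natrM bE mulN1r subr_eq0 eq_sym -subr_eq0.
  by rewrite -(natrB _ j0) natK_neq0 //; lia.
by apply: (UVZ c0); rewrite scalerDl scale1r.
Qed.

End KeyLemma.

(** * T-spaces between consecutive terms of the filtration *)

Definition proper_homog (K : comNzRingType) (A : algType K) (x y : A) (d : nat)
    (w : A) : Prop :=
  exists c : nat -> A, (forall i, (i < d.+1)%N -> proper_poly x y i (d - i) (c i))
    /\ w = \sum_(i < d.+1) c i.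

(** The ideal that the proper polynomials of degree [d] in [U] generate together with
    [filt x y d.+1]. *)
Inductive mon_span (K : comNzRingType) (A : algType K) (x y : A) (d : nat)
    (U : set A) : A -> Prop :=
  | mon_span_filt r : filt x y d.+1 r -> mon_span x y d U r
  | mon_spanD u v : mon_span x y d U u -> mon_span x y d U v ->
      mon_span x y d U (u + v)
  | mon_span_mon a b w : proper_homog x y d w -> U w ->
      mon_span x y d U (mon x y a b * w).

(** Polynomials in [z] with left coefficients in [S]. Nesting it, first in [y] and then in [x],
    gives a normal form for [P d]. *)
Definition pol_span (K : comNzRingType) (A : algType K) (z : A) (S : set A)
    (u : A) : Prop :=
  exists p : {poly A}, (forall i, S p`_i) /\ u = p.[z].

Section PolSpan.
Variables (K : comNzRingType) (A : algType K) (z : A) (S : set A).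
Hypothesis sS : subspace S.
Implicit Types (a u v : A).

Lemma pol_span_subspace : subspace (pol_span z S).
Proof.
have [S0 SD SZ] := sS; split.
- by exists 0; split=> [i|]; rewrite ?coef0 ?horner0.
- move=> u v [p [Sp ->]] [q [Sq ->]]; exists (p + q); split=> [i|].
    by rewrite coefD; exact: SD.
  by rewrite hornerD.
- move=> k u [p [Sp ->]]; exists (k%:A *: p); split=> [i|].
    by rewrite coefZ -scalerAl mul1r; exact: SZ.
  by rewrite hornerZ -scalerAl mul1r.
Qed.

Lemma pol_span_sub u : S u -> pol_span z S u.
Proof.
move=> Su; exists u%:P; split=> [i|]; last by rewrite hornerC.
by rewrite coefC; case: eqP => // _; case: sS.
Qed.

Lemma pol_spanX u : pol_span z S u -> pol_span z S (u * z).
Proof.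
move=> [p [Sp ->]]; exists (p * 'X); split=> [i|]; last by rewrite hornerMX.
by rewrite coefMX; case: eqP => // _; case: sS.
Qed.

Lemma pol_spanM a u : (forall v, S v -> S (a * v)) ->
  pol_span z S u -> pol_span z S (a * u).
Proof.
move=> Sa [p [Sp ->]]; exists (a *: p); split=> [i|]; last by rewrite hornerZ.
by rewrite coefZ; exact: Sa.
Qed.

Lemma pol_span_ideal (J : set A) u : ideal J -> S `<=` J ->
  pol_span z S u -> J u.
Proof.
move=> idJ SJ [p [Sp ->]]; rewrite horner_coef.
apply: (subspace_sum _ (ideal_subspace idJ)) => i _.
by apply: (ideal_mulr idJ); apply: SJ.
Qed.

End PolSpan.

Section Homogeneous.
Variables (K : fieldType) (A : algType K) (x y : A).
Hypothesis gen : generates x y.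
Hypothesis free : free_on x y.
Hypothesis infK : infinite_set [set: K].
Variable d : nat.
Hypothesis d_gt1 : (1 < d)%N.
Implicit Types (a b i j m : nat) (c u v w : A) (S L : set A).

Local Notation W := (proper_poly x y).
Local Notation P := (filt x y).
Local Notation M := (mon x y).
Local Notation Wd := (proper_homog x y d).

Lemma proper_scale (phi : {lrmorphism A -> A}) (s : K) i j w :
  phi x = s *: x -> phi y = y -> W i j w -> phi w = s ^+ i *: w.
Proof.
move=> px py Ww.
have pC u v : phi (comm u v) = comm (phi u) (phi v).
  by rewrite /comm rmorphB !rmorphM.
elim: i j w / Ww => [|i j c _ IH|i j c _ IH|i j k l c c' _ IH _ IH'
  |i j|i j c c' _ IH _ IH'|k i j c _ IH].
- by rewrite pC px py commZl.
- by rewrite pC IH px commZl commZr scalerA -exprSr.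
- by rewrite pC IH py commZl.
- by rewrite rmorphM /= IH IH' -scalerAl -scalerAr scalerA exprD.
- by rewrite rmorph0 scaler0.
- by rewrite rmorphD /= IH IH' scalerDr.
- by rewrite linearZ /= IH !scalerA mulrC.
Qed.

(** Commutators do not see scalar summands, so translations fix proper polynomials. *)
Lemma proper_shift (phi : {lrmorphism A -> A}) (s t : K) i j w :
  phi x = x + s%:A -> phi y = y + t%:A -> W i j w -> phi w = w.
Proof.
move=> px py Ww.
have pC u v : phi (comm u v) = comm (phi u) (phi v).
  by rewrite /comm rmorphB !rmorphM.
elim: i j w / Ww => [|i j c _ IH|i j c _ IH|i j k l c c' _ IH _ IH'
  |i j|i j c c' _ IH _ IH'|k i j c _ IH].
- by rewrite pC px py commDr commA addr0 commDl [comm _%:A _]commN commA subr0.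
- by rewrite pC IH px commDr commA addr0.
- by rewrite pC IH py commDr commA addr0.
- by rewrite rmorphM /= IH IH'.
- by rewrite rmorph0.
- by rewrite rmorphD /= IH IH'.
- by rewrite linearZ /= IH.
Qed.

Lemma proper_homogE i j w : (i + j = d)%N -> W i j w -> Wd w.
Proof.
move=> ijd Ww; exists (fun k => if k == i then w else 0); split=> [k kd|].
  case: eqP => [->|_]; last exact: proper_poly0.
  by have -> : (d - i = j)%N by lia.
have id : (i < d.+1)%N by lia.
rewrite (bigD1 (Ordinal id)) //= eqxx big1 ?addr0 // => k.
by rewrite -val_eqE /= => /negPf ->.
Qed.

Lemma proper_homog_filt w : Wd w -> P d w.
Proof.
move=> [c [Wc ->]].
apply: (subspace_sum _ (ideal_subspace (ideal_filt gen _))) => i _.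
have := filt_proper (Wc i (ltn_ord i)).
by have -> : (i + (d - i) = d)%N by have := ltn_ord i; lia.
Qed.

Lemma proper_homog_subspace : subspace Wd.
Proof.
split.
- by exists (fun=> 0); split=> [i _|]; [exact: proper_poly0|rewrite big1].
- move=> u v [c [Wc ->]] [c' [Wc' ->]]; exists (fun i => c i + c' i).
  split=> [i id|]; last by rewrite big_split.
  by apply: proper_polyD; [exact: Wc|exact: Wc'].
- move=> k u [c [Wc ->]]; exists (fun i => k *: c i).
  split=> [i id|]; last by rewrite scaler_sumr.
  by apply: proper_polyZ; exact: Wc.
Qed.

Lemma proper_homog_shift (phi : {lrmorphism A -> A}) (s t : K) w :
  phi x = x + s%:A -> phi y = y + t%:A -> Wd w -> phi w = w.
Proof.
move=> px py [c [Wc ->]]; rewrite rmorph_sum; apply: eq_bigr => i _.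
exact: (proper_shift px py (Wc i (ltn_ord i))).
Qed.

Let S0 : set A := [set u | exists w r, [/\ Wd w, P d.+1 r & u = w + r]].
Let G : set A := pol_span y S0.

Let S0_subspace : subspace S0.
Proof.
have [W0 WD WZ] := proper_homog_subspace.
have [P0 PD PZ] := ideal_subspace (ideal_filt gen d.+1).
split.
- by exists 0, 0; split=> //; rewrite addr0.
- move=> u v [w [r [Ww Pr ->]]] [w' [r' [Ww' Pr' ->]]]; exists (w + w'), (r + r').
  by split; [exact: WD|exact: PD|rewrite addrACA].
- move=> k u [w [r [Ww Pr ->]]]; exists (k *: w), (k *: r).
  by split; [exact: WZ|exact: PZ|rewrite scalerDr].
Qed.

Let S0_filt u : P d.+1 u -> S0 u.
Proof.
by exists 0, u; split=> //; [case: proper_homog_subspace|rewrite add0r].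
Qed.

Let S0_sub : S0 `<=` P d.
Proof.
move=> _ [w [r [Ww Pr ->]]]; apply: filt_add; first exact: proper_homog_filt.
exact: filt_le Pr.
Qed.

(** Elements of [P d] commute with [x] and [y] modulo [P d.+1], so left multiplication by a
    generator may be replaced by right multiplication. *)
Lemma filt_pol_span u : P d u -> pol_span x G u.
Proof.
have sG : subspace G := pol_span_subspace y S0_subspace.
have sQ := pol_span_subspace x sG.
have [Q0 QD QZ] := sQ.
have PG v : P d.+1 v -> G v by move=> Pv; apply: pol_span_sub => //; exact: S0_filt.
have PQ v : P d.+1 v -> pol_span x G v by move=> Pv; apply: pol_span_sub => //; exact: PG.
have GP : G `<=` P d by move=> v; exact: (pol_span_ideal (ideal_filt gen d) S0_sub).
have QP v : pol_span x G v -> P d v.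
  exact: (pol_span_ideal (ideal_filt gen d) GP).
have Gy v : G v -> G (y * v).
  move=> Gv; have -> : y * v = v * y + comm y v by ncring.
  have [_ GD _] := sG; apply: GD; first exact: pol_spanX.
  apply: PG; rewrite commN; apply: (idealN (ideal_filt gen _)).
  by apply: (filt_comm gen); exact: GP.
have Qmul (b : A) : forall v, pol_span x G v -> pol_span x G (b * v).
  move: b; apply: gen.
  - move=> v Qv; have -> : x * v = v * x + comm x v by ncring.
    apply: QD; first exact: pol_spanX.
    apply: PQ; rewrite commN; apply: (idealN (ideal_filt gen _)).
    by apply: (filt_comm gen); exact: QP.
  - by move=> v Qv; apply: pol_spanM.
  - by move=> k v Qv; rewrite -scalerAl mul1r; exact: QZ.
  - by move=> b b' Hb Hb' v Qv; rewrite mulrDl; apply: QD; auto.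
  - by move=> b b' Hb Hb' v Qv; rewrite -mulrA; auto.
move=> Pu0; elim: u / Pu0 => [b d1| |u v _ Pu _ Pv|b i j w dij Ww] //.
- lia.
- exact: QD.
apply: Qmul; move: dij; rewrite leq_eqVlt => /orP[/eqP dij|dij]; last first.
  by apply: PQ; apply: filt_le (filt_proper Ww).
apply: pol_span_sub => //; apply: pol_span_sub => //.
exists w, 0; split; rewrite ?addr0 //; last exact: filt_zero.
exact: (proper_homogE _ Ww).
Qed.

Section Tspaces.
Variable U : set A.
Hypothesis TU : Tspace U.
Hypothesis PU : P d.+1 `<=` U.

Let sU : subspace U. Proof. by case: TU. Qed.

Lemma ideal_mon_span : ideal (mon_span x y d U).
Proof.
have Lmul (b : A) : forall v, mon_span x y d U v -> mon_span x y d U (b * v).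
  move: b; apply: gen.
  - move=> v Lv; elim: v / Lv => [r Pr|u v _ Lu _ Lv|a b w Ww Uw].
    + by apply: mon_span_filt; exact: (ideal_mull (ideal_filt gen _)).
    + by rewrite mulrDr; exact: mon_spanD.
    + by rewrite /mon !mulrA -exprS; exact: (mon_span_mon a.+1 b).
  - move=> v Lv; elim: v / Lv => [r Pr|u v _ Lu _ Lv|a b w Ww Uw].
    + by apply: mon_span_filt; exact: (ideal_mull (ideal_filt gen _)).
    + by rewrite mulrDr; exact: mon_spanD.
    + have := mon_mul gen 0 1 a b (proper_homog_filt Ww).
      rewrite {1}/mon expr0 mul1r expr1 => Pr.
      rewrite -[y * _](subrK (M (0 + a) (1 + b) * w)).
      by apply: mon_spanD; [exact: mon_span_filt|exact: mon_span_mon].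
  - move=> k v Lv; rewrite -scalerAl mul1r.
    elim: v / Lv => [r Pr|u v _ Lu _ Lv|a b w Ww Uw].
    + by apply: mon_span_filt; exact: (idealZ (ideal_filt gen _)).
    + by rewrite scalerDr; exact: mon_spanD.
    + rewrite scalerAr; have [_ _ WZ] := proper_homog_subspace; have [_ _ UZ] := sU.
      by apply: mon_span_mon; [exact: WZ|exact: UZ].
  - by move=> b b' Hb Hb' v Lv; rewrite mulrDl; apply: mon_spanD; auto.
  - by move=> b b' Hb Hb' v Lv; rewrite -mulrA; auto.
have LP : mon_span x y d U `<=` P d.
  move=> v Lv; elim: v / Lv => [r Pr|u v _ Lu _ Lv|a b w Ww Uw].
  - exact: filt_le Pr.
  - exact: filt_add.
  - by apply: (ideal_mull (ideal_filt gen _)); exact: proper_homog_filt.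
split=> [|u v||b u Lu]; first by apply: mon_span_filt; exact: filt_zero.
- exact: mon_spanD.
- exact: Lmul.
- have -> : u * b = b * u + comm u b by ncring.
  apply: mon_spanD; first exact: Lmul.
  by apply: mon_span_filt; apply: (filt_comm gen); exact: LP.
Qed.

Hypothesis Umon : forall a b i j w, (i + j = d)%N -> W i j w -> U w ->
  U (M a b * w).

Lemma mon_span_sub : mon_span x y d U `<=` U.
Proof.
move=> v Lv; elim: v / Lv => [r Pr|u v _ Lu _ Lv|a b w Ww Uw].
- exact: PU.
- by have [_ UD _] := sU; exact: UD.
have [c [Wc wE]] := Ww.
(* Substituting [s x] for [x] scales the component of [x]-degree [i] by [s^i], which separates the
   components inside [U]. *)
have Uc (i : 'I_d.+1) : U (c i).
  apply: (@vandermonde_coef _ _ U d.+1 (fun i : 'I_d.+1 => c i) infK sU _ i) => s.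
  have [phi [px py]] := free (s *: x) y.
  have [_ /(_ phi _ Uw)] := TU; rewrite wE rmorph_sum; congr U.
  by apply: eq_bigr => k _; exact: (proper_scale px py (Wc k (ltn_ord k))).
rewrite wE mulr_sumr; apply: (subspace_sum _ sU) => i _.
apply: (Umon _ _ _ (Wc i (ltn_ord i))) => //.
by have := ltn_ord i; lia.
Qed.

(* Substituting [z + s] for [z] in [p.[z]] and extracting the coefficient of the
   highest power of [s] isolates the leading coefficient of [p]. *)
Lemma shift_coef S L (z : A) (p : {poly A}) :
  ideal L -> L `<=` U -> subspace S -> (forall c, S c -> U c -> L c) ->
  (forall s : K, exists phi : {lrmorphism A -> A},
     phi z = z + s%:A /\ forall c, S c -> P d.+1 (phi c - c)) ->
  (forall i, S p`_i) -> U p.[z] -> forall i, L p`_i.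
Proof.
move=> idL LU sS SL Hphi.
have [m] := ubnP (size p); elim: m p => // m IH p; rewrite ltnS => pm Sp Up i.
move: pm; rewrite leq_eqVlt => /orP[/eqP mE|pm]; last exact: IH.
case: m mE IH => [|m] mE IH.
  by rewrite nth_default ?mE //; exact: (ideal0 idL).
have Us (s : K) : U p.[z + s%:A].
  have [phi [pz pS]] := Hphi s.
  have -> : p.[z + s%:A] = phi p.[z] - (phi p.[z] - p.[z + s%:A]).
    by rewrite subKr.
  apply: subspaceB => //; first by have [_] := TU; apply.
  apply: PU; rewrite !horner_coef rmorph_sum -sumrB.
  apply: (subspace_sum _ (ideal_subspace (ideal_filt gen _))) => k _.
  rewrite rmorphM rmorphXn /= pz -mulrBl.
  by apply: (ideal_mulr (ideal_filt gen _)); exact: pS.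
have Um : U (p^`N(m)).[z].
  have mlt : (m < size p)%N by rewrite mE.
  apply: (@vandermonde_coef _ _ U (size p) (fun k => (p^`N(k)).[z]) infK sU _
    (Ordinal mlt)) => s.
  have := Us s; rewrite nderiv_taylor; last first.
    by rewrite /GRing.comm -scalerAr -scalerAl mulr1 mul1r.
  by congr U; apply: eq_bigr => k _; rewrite exprZn expr1n -scalerAr mulr1.
have pm : p^`N(m) = (p`_m)%:P.
  apply/polyP => k; rewrite coef_nderivn coefC.
  case: k => [|k]; first by rewrite addn0 binn mulr1n.
  by rewrite nth_default ?mul0rn // mE; lia.
rewrite pm hornerC in Um.
have Lm : L p`_m by apply: SL.
(* The leading term evaluates into the ideal [L], hence into [U], and can be removed before the
   induction on size. *)
pose q := p - p`_m *: 'X^m.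
have qE k : q`_k = if k == m then 0 else p`_k.
  rewrite /q coefB coefZ coefXn; case: eqP => [->|_]; first by rewrite mulr1 subrr.
  by rewrite mulr0 subr0.
have qm : (size q <= m)%N.
  apply/leq_sizeP => k mk; rewrite qE; case: eqP => // km.
  by rewrite nth_default // mE; lia.
have Sq k : S q`_k by rewrite qE; case: eqP => // _; case: sS.
have Uq : U q.[z].
  rewrite /q hornerD hornerN hornerZ hornerXn; apply: subspaceB => //.
  by apply: LU; exact: (ideal_mulr idL).
have Lq k : L q`_k by apply: IH.
by have := Lq i; rewrite qE; case: eqP => [-> //|].
Qed.

(** [shift_coef] is used twice on the normal form: in [x] with coefficients from [G], and in [y]
    with coefficients from [S0], where the claim is immediate. *)
Lemma Tspace_mon_span : U `<=` P d -> U = mon_span x y d U.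
Proof.
move=> UP; apply/seteqP; split; last exact: mon_span_sub.
set L := mon_span x y d U.
have idL : ideal L := ideal_mon_span.
have PL v : P d.+1 v -> L v by exact: mon_span_filt.
have PI c : P d.+1 (c - c) by rewrite subrr; exact: filt_zero.
have phiP phi r : P d.+1 r -> P d.+1 ((phi : {lrmorphism A -> A}) r - r).
  move=> Pr; apply: (idealB (ideal_filt gen _)) => //.
  exact: (filt_morph gen).
have S0L c : S0 c -> U c -> L c.
  move=> [w [r [Ww Pr ->]]] Uc; apply: mon_spanD; last exact: PL.
  rewrite -[w]mul1r; have -> : 1 = M 0 0 by rewrite /mon !expr0 mulr1.
  apply: mon_span_mon => //; rewrite -[w](addrK r).
  by apply: subspaceB => //; exact: PU.
have S0shift (s t : K) (phi : {lrmorphism A -> A}) c :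
    phi x = x + s%:A -> phi y = y + t%:A -> S0 c -> P d.+1 (phi c - c).
  move=> px py [w [r [Ww Pr ->]]]; rewrite rmorphD /= (proper_homog_shift px py Ww).
  by rewrite opprD addrACA subrr add0r; exact: phiP.
have GL c : G c -> U c -> L c.
  move=> [q [Sq cE]] Uc; have Lq i : L q`_i.
    apply: (shift_coef idL mon_span_sub S0_subspace S0L _ Sq (z := y)).
      move=> s; have [phi [px py]] := free x (y + s%:A).
      exists phi; split=> // c'; apply: (S0shift 0 s) => //.
      by rewrite px scale0r addr0.
    by rewrite -cE.
  rewrite cE horner_coef; apply: (subspace_sum _ (ideal_subspace idL)) => i _.
  exact: (ideal_mulr idL).
move=> u Uu; have [p [Gp uE]] := filt_pol_span (UP u Uu).
have Lp i : L p`_i.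
  apply: (shift_coef idL mon_span_sub (pol_span_subspace y S0_subspace) GL _ Gp (z := x)).
    move=> s; have [phi [px py]] := free (x + s%:A) y.
    exists phi; split=> // _ [q [Sq ->]].
    rewrite !horner_coef rmorph_sum -sumrB.
    apply: (subspace_sum _ (ideal_subspace (ideal_filt gen _))) => k _.
    rewrite rmorphM rmorphXn /= py -mulrBl.
    apply: (ideal_mulr (ideal_filt gen _)); apply: (S0shift s 0) => //.
    by rewrite py scale0r addr0.
  by rewrite -uE.
rewrite uE horner_coef; apply: (subspace_sum _ (ideal_subspace idL)) => i _.
exact: (ideal_mulr idL).
Qed.

End Tspaces.
End Homogeneous.

(** * Chains of T-spaces *)

Section Rank.
Variables (K : fieldType) (A : algType K).
Implicit Types (u v a : A) (s : seq A) (S T : set A).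

Fixpoint lin_span s v : Prop :=
  if s is a :: s' then exists k v', lin_span s' v' /\ v = k *: a + v' else v = 0.

(* Gaussian elimination: the dimension of [S `&` lin_span s] when [S] is a
   subspace. *)
Fixpoint span_rank s S : nat :=
  if s is a :: s' then (`[< exists v, lin_span s' v /\ S (a + v)%R >] + span_rank s' S)%N
  else 0%N.

Lemma lin_span_subspace s : subspace (lin_span s).
Proof.
elim: s => [|a s [S0 SD SZ]] /=.
  by split=> // [u v -> ->|k u ->]; rewrite ?addr0 ?scaler0.
split.
- by exists 0, 0; split=> //; rewrite scale0r addr0.
- move=> u v [k [u' [Su ->]]] [l [v' [Sv ->]]]; exists (k + l), (u' + v').
  by split; [exact: SD|rewrite scalerDl addrACA].
- move=> k u [l [u' [Su ->]]]; exists (k * l), (k *: u').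
  by split; [exact: SZ|rewrite scalerDr scalerA].
Qed.

Lemma lin_span_mem s a : a \in s -> lin_span s a.
Proof.
elim: s => // b s IH; rewrite inE => /orP[/eqP <-|/IH Sa] /=.
  by exists 1, 0; split; [case: (lin_span_subspace s)|rewrite scale1r addr0].
by exists 0, a; split=> //; rewrite scale0r add0r.
Qed.

Lemma lin_span_min s T : subspace T -> (forall a, a \in s -> T a) ->
  lin_span s `<=` T.
Proof.
move=> sT; elim: s => [_ _ -> |a s IH Ts v [k [v' [Sv ->]]]].
  by case: sT.
have [_ TD TZ] := sT; apply: TD; first by apply: TZ; apply: Ts; rewrite mem_head.
by apply: IH Sv => b bs; apply: Ts; rewrite inE bs orbT.
Qed.

Lemma span_rank_mono s S T : S `<=` T -> (span_rank s S <= span_rank s T)%N.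
Proof.
move=> ST; elim: s => //= a s IH; apply: leq_add => //.
case: asboolP => // -[v [sv Sv]]; case: asboolP => // -[].
by exists v; split=> //; exact: ST.
Qed.

(** Equal ranks force equal pivots. Where [S] has a pivot [a + v], subtracting a multiple of it
    moves an element of [T] into the span of the tail. *)
Lemma span_rank_eq s S T : subspace S -> subspace T -> S `<=` T ->
  (span_rank s T <= span_rank s S)%N -> forall v, lin_span s v -> T v -> S v.
Proof.
move=> sS sT ST; elim: s => [_ v -> _|a s IH /=]; first by case: sS.
have mono := span_rank_mono s ST.
have [[v [sv Sv]]|nS] := asboolP (exists v, lin_span s v /\ S (a + v)); last first.
  have [//|nT] := asboolP (exists v, lin_span s v /\ T (a + v)).
    by rewrite add0n add1n ltnNge mono.
  rewrite !add0n => /IH H v [k [v' [sv' ->]]] Tv.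
  have [k0|k0] := eqVneq k 0.
    by rewrite k0 scale0r add0r; apply: H => //; rewrite k0 scale0r add0r in Tv.
  case: nT; exists (k^-1 *: v'); split.
    by have [_ _] := lin_span_subspace s; apply.
  have -> : a + k^-1 *: v' = k^-1 *: (k *: a + v').
    by rewrite scalerDr scalerA mulVf // scale1r.
  by have [_ _] := sT; apply.
have -> /= : `[< exists v, lin_span s v /\ T (a + v) >].
  by apply/asboolP; exists v; split=> //; exact: ST.
rewrite leq_add2l => /IH H _ [k [v' [sv' ->]]] Tv.
have -> : k *: a + v' = k *: (a + v) + (v' - k *: v).
  by rewrite scalerDr; ncring.
have [_ SD SZ] := sS; apply: SD; first exact: SZ.
have slin := lin_span_subspace s; have [_ _ LZ] := slin.
apply: H; first by apply: subspaceB => //; exact: LZ.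
have -> : v' - k *: v = k *: a + v' - k *: (a + v) by rewrite scalerDr; ncring.
by apply: subspaceB => //; have [_ _] := sT; apply=> //; exact: ST.
Qed.

End Rank.

Section Sums.
Variables (K : fieldType) (A : algType K).
Implicit Types (u v : A) (s : seq A) (S T U V : set A).

Definition tsum U V : set A := [set w | exists u v, [/\ U u, V v & w = u + v]].

Lemma Tspace_tsum U V : Tspace U -> Tspace V -> Tspace (tsum U V).
Proof.
move=> [[U0 UD UZ] UT] [[V0 VD VZ] VT]; split; first split.
- by exists 0, 0; rewrite addr0.
- move=> _ _ [u [v [Uu Vv ->]]] [u' [v' [Uu' Vv' ->]]]; exists (u + u'), (v + v').
  by split; [exact: UD|exact: VD|rewrite addrACA].
- move=> k _ [u [v [Uu Vv ->]]]; exists (k *: u), (k *: v).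
  by split; [exact: UZ|exact: VZ|rewrite scalerDr].
- move=> f _ [u [v [Uu Vv ->]]]; exists (f u), (f v).
  by split; [exact: UT|exact: VT|rewrite rmorphD].
Qed.

Lemma tsum_subl U V : V 0 -> U `<=` tsum U V.
Proof. by move=> V0 u Uu; exists u, 0; rewrite addr0. Qed.

Lemma tsum_subr U V : U 0 -> V `<=` tsum U V.
Proof. by move=> U0 v Vv; exists 0, v; rewrite add0r. Qed.

Lemma tsum_min U V S : subspace S -> U `<=` S -> V `<=` S -> tsum U V `<=` S.
Proof.
move=> [_ SD _] US VS _ [u [v [Uu Vv ->]]].
by apply: SD; [exact: US|exact: VS].
Qed.

Lemma TspaceI U V : Tspace U -> Tspace V -> Tspace (U `&` V).
Proof.
move=> [[U0 UD UZ] UT] [[V0 VD VZ] VT]; split; first split.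
- by [].
- by move=> u v [Uu Vu] [Uv Vv]; split; [exact: UD|exact: VD].
- by move=> k u [Uu Vu]; split; [exact: UZ|exact: VZ].
- by move=> f u [Uu Vu]; split; [exact: UT|exact: VT].
Qed.

Lemma idealI U V : ideal U -> ideal V -> ideal (U `&` V).
Proof.
move=> [U0 UD Ul Ur] [V0 VD Vl Vr]; split.
- by [].
- by move=> u v [Uu Vu] [Uv Vv]; split; [exact: UD|exact: VD].
- by move=> k u [Uu Vu]; split; [exact: Ul|exact: Vl].
- by move=> k u [Uu Vu]; split; [exact: Ur|exact: Vr].
Qed.

Lemma Tspace_Tcomm m : Tspace (@Tcomm K A m).
Proof.
split; first exact: (ideal_subspace (ideal_Tcomm A m)).
by move=> f u; exact: Tcomm_morph.
Qed.

Lemma Tspan_Tspace G : Tspace (@Tspan K A G).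
Proof.
split; first split.
- by move=> U [[[U0 _ _] _] _].
- move=> u v Gu Gv U HU; have [[[_ UD _] _] _] := HU.
  by apply: UD; [exact: Gu|exact: Gv].
- by move=> k u Gu U HU; have [[[_ _ UZ] _] _] := HU; apply: UZ; exact: Gu.
- by move=> f u Gu U HU; have [[_ UT] _] := HU; apply: UT; exact: Gu.
Qed.

Lemma Tspan_min G U : Tspace U -> G `<=` U -> Tspan G `<=` U.
Proof. by move=> TU GU u; apply. Qed.

Lemma sub_Tspan G : G `<=` @Tspan K A G.
Proof. by move=> u Gu U [_]; apply. Qed.

Lemma Tspan_mono G G' : G `<=` G' -> @Tspan K A G `<=` Tspan G'.
Proof.
move=> GG'; apply: Tspan_min; first exact: Tspan_Tspace.
by apply: subset_trans GG' _; exact: sub_Tspan.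
Qed.

Definition Tcovers U V : Prop :=
  U `<` V /\ ~ exists W, [/\ Tspace W, U `<` W & W `<` V].

Inductive Tnormal_chain : set A -> set A -> Prop :=
  | Tnormal_nil U : Tspace U -> ideal U -> Tnormal_chain U U
  | Tnormal_cons U U1 V : Tspace U -> ideal U -> Tcovers U U1 ->
      Tnormal_chain U1 V -> Tnormal_chain U V.

Lemma Tnormal_trans U V T :
  Tnormal_chain U V -> Tnormal_chain V T -> Tnormal_chain U T.
Proof.
move=> UV VT; elim: UV VT => // {}U U1 {}V TU iU UU1 _ IH /IH.
exact: Tnormal_cons.
Qed.

(** Induction on [mu V - mu U]: a T-space strictly between stays in [C] by convexity, and [mu] grows
    strictly on both sides of it. *)
Lemma Tnormal_chain_refine (C : set (set A)) (mu : set A -> nat) :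
  (forall U, C U -> Tspace U /\ ideal U) ->
  (forall U V T, C U -> C V -> Tspace T -> U `<=` T -> T `<=` V -> C T) ->
  (forall U V, C U -> C V -> U `<=` V -> (mu V <= mu U)%N -> V `<=` U) ->
  forall U V, C U -> C V -> U `<=` V -> Tnormal_chain U V.
Proof.
move=> CT Cconv Cmu U V.
have [m] := ubnP (mu V - mu U); elim: m U V => // m IH U V mUV CU CV UV.
have [TU iU] := CT _ CU.
have [VU|nVU] := pselect (V `<=` U).
  have -> : V = U by apply/seteqP.
  exact: Tnormal_nil.
have [[W [TW [UW nWU] [WV nVW]]]|nW] :=
    pselect (exists W, [/\ Tspace W, U `<` W & W `<` V]).
  have CW := Cconv _ _ _ CU CV TW UW WV.
  have mUW : (mu U < mu W)%N by rewrite ltnNge; apply/negP => /(Cmu _ _ CU CW UW).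
  have mWV : (mu W < mu V)%N by rewrite ltnNge; apply/negP => /(Cmu _ _ CW CV WV).
  by apply: (@Tnormal_trans _ W); apply: IH => //; lia.
have [TV iV] := CT _ CV.
by apply: (Tnormal_cons TU iU _ (Tnormal_nil TV iV)); split.
Qed.

Lemma Tnormal_chain_series U V : Tnormal_chain U V ->
  exists k (F : nat -> set A), [/\ F 0%N = U, F k = V,
    forall i, (i <= k)%N -> Tspace (F i) /\ ideal (F i)
    & forall i, (i < k)%N -> Tcovers (F i) (F i.+1)].
Proof.
elim=> {U V} [U TU iU|U U1 V TU iU UU1 _ [k [F [F0 Fk FT FC]]]].
  by exists 0%N, (fun=> U).
exists k.+1, (fun i => if i is i'.+1 then F i' else U); split=> // -[|i] ik //.
- exact: FT.
- by rewrite F0.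
- exact: FC.
Qed.

Lemma Tnormal_chain_Tspace U V : Tnormal_chain U V -> Tspace U.
Proof. by case. Qed.

(** Descending the chain, a generator is added only at a factor where [W] meets [U1] outside [U]. *)
Lemma Tnormal_chain_fg U V : Tnormal_chain U V -> forall W, Tspace W -> W `<=` V ->
  exists s : seq A, [set` s] `<=` W /\ W `<=` tsum (Tspan [set` s]) U.
Proof.
elim=> {U V} [U TU iU|U U1 V TU iU [[UU1 nU1U] nmid] U1V IH] W TW WV.
  exists [::]; split=> // w Ww; apply: tsum_subr; last exact: WV.
  by have [[]] := Tspan_Tspace [set` [::]].
have [s [sW Ws]] := IH W TW WV.
have sTW : Tspan [set` s] `<=` W by exact: Tspan_min.
have [[W0 WD WZ] WT] := TW.
have Wsub v w : W v -> W w -> W (v - w).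
  by apply: subspaceB.
have [WU|] := pselect (W `&` U1 `<=` U).
  exists s; split=> // w Ww; have [u [v [su U1v wE]]] := Ws w Ww.
  exists u, v; split=> //; apply: WU; split=> //.
  have -> : v = w - u by rewrite wE addrC addKr.
  by apply: Wsub => //; exact: sTW.
move/existsNP => [g /not_implyP[[Wg U1g] nUg]].
have TU1 := Tnormal_chain_Tspace U1V.
(* [Y] is strictly above [U] and inside [U1]; as nothing lies strictly between, it is [U1]. *)
pose Y := tsum (Tspan [set` [:: g]]) U.
have TY : Tspace Y by apply: Tspace_tsum => //; exact: Tspan_Tspace.
have Tg0 : Tspan [set` [:: g]] (0 : A) by have [[]] := Tspan_Tspace [set` [:: g]].
have gY : Y g.
  by apply: tsum_subl; [case: TU => -[]|apply: sub_Tspan; rewrite /= mem_seq1].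
have U1Y : U1 `<=` Y.
  apply: contrapT => nU1Y; apply: nmid; exists Y; split=> //.
    by split; [exact: tsum_subr|move=> YU; apply: nUg; exact: YU].
  split=> //; apply: tsum_min => //; first by case: TU1.
  by apply: Tspan_min => // t /=; rewrite mem_seq1 => /eqP ->.
exists (g :: s); split=> [u /=|w Ww].
  by rewrite inE => /orP[/eqP ->//|]; exact: sW.
have [u [v [su U1v ->]]] := Ws w Ww.
have [u' [v' [gu' Uv' ->]]] := U1Y v U1v.
exists (u + u'), v'; split=> //; last by rewrite addrA.
have [[_ GD _] _] := Tspan_Tspace [set` g :: s]; apply: GD.
  by apply: Tspan_mono su => t /= ts; rewrite inE ts orbT.
by apply: Tspan_mono gu' => t /=; rewrite mem_seq1 => /eqP ->; rewrite mem_head.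
Qed.


End Sums.

(** * Finite spanning sets for the proper polynomials *)

Section Words.
Variables (K : fieldType) (A : algType K) (x y : A).
Implicit Types (u v w : A).

Fixpoint words (d : nat) : seq A :=
  if d is d'.+1 then [seq x * u | u <- words d'] ++ [seq y * u | u <- words d']
  else [:: 1].

Let span d := lin_span (words d).

Let span_mulx d u : span d u -> span d.+1 (x * u).
Proof.
have [S0 SD SZ] := lin_span_subspace (words d.+1).
apply: (@lin_span_min _ _ (words d) [set u | span d.+1 (x * u)]) => [|a ad] /=.
  split=> /= [|v w Sv Sw|k v Sv]; first by rewrite mulr0.
    by rewrite mulrDr; exact: SD.
  by rewrite -scalerAr; exact: SZ.
by apply: lin_span_mem; rewrite mem_cat map_f.
Qed.

Let span_muly d u : span d u -> span d.+1 (y * u).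
Proof.
have [S0 SD SZ] := lin_span_subspace (words d.+1).
apply: (@lin_span_min _ _ (words d) [set u | span d.+1 (y * u)]) => [|a ad] /=.
  split=> /= [|v w Sv Sw|k v Sv]; first by rewrite mulr0.
    by rewrite mulrDr; exact: SD.
  by rewrite -scalerAr; exact: SZ.
by apply: lin_span_mem; rewrite mem_cat map_f ?orbT.
Qed.

Let span_mul d e u v : span d u -> span e v -> span (d + e) (u * v).
Proof.
have [S0 SD SZ] := lin_span_subspace (words (d + e)).
move=> du ev; move: u du.
apply: (@lin_span_min _ _ (words d) [set u | span (d + e) (u * v)]) => [|a] /=.
  split=> /= [|u w Sv Sw|k u Sv]; first by rewrite mul0r.
    by rewrite mulrDl; exact: SD.
  by rewrite -scalerAl; exact: SZ.
elim: d {S0 SD SZ} a => [|d IH] a /=.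
  by rewrite inE => /eqP ->; rewrite mul1r.
rewrite mem_cat => /orP[] /mapP[u du ->]; rewrite -mulrA.
  by apply: span_mulx; exact: IH.
by apply: span_muly; exact: IH.
Qed.

Lemma proper_poly_words i j w : proper_poly x y i j w -> lin_span (words (i + j)) w.
Proof.
suff : proper_poly x y i j w -> span (i + j) w by [].
have span1 : span 0 1 by apply: lin_span_mem; rewrite inE.
have spx : span 1 x by rewrite -[x]mulr1; exact: span_mulx.
have spy : span 1 y by rewrite -[y]mulr1; exact: span_muly.
have spC d e u v : span d u -> span e v -> span (d + e) (comm u v).
  move=> du ev; apply: (subspaceB (lin_span_subspace _)); first exact: span_mul.
  by rewrite addnC; exact: span_mul.
move=> Ww; elim: i j w / Ww => [|i j c _ IH|i j c _ IH|i j k l c c' _ IH _ IH'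
  |i j|i j c c' _ IH _ IH'|k i j c _ IH].
- exact: spC.
- by rewrite addSn -addn1; exact: spC.
- by rewrite addnS -addn1; exact: spC.
- by rewrite addnACA; exact: span_mul.
- by have [] := lin_span_subspace (words (i + j)).
- by have [_ SD _] := lin_span_subspace (words (i + j)); exact: SD.
- by have [_ _ SZ] := lin_span_subspace (words (i + j)); exact: SZ.
Qed.

Lemma proper_homog_words d w : proper_homog x y d w -> lin_span (words d) w.
Proof.
move=> [c [Wc ->]]; apply: (subspace_sum _ (lin_span_subspace _)) => i _.
have := proper_poly_words (Wc i (ltn_ord i)).
by have -> : (i + (d - i) = d)%N by have := ltn_ord i; lia.
Qed.

End Words.

(** * The T-normal series of T^(3) *)

Section Assembly.
Variables (K : fieldType) (A : algType K) (x y : A).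
Hypothesis gen : generates x y.
Hypothesis free : free_on x y.
Hypothesis infK : infinite_set [set: K].
Variables (p n : nat).
Hypothesis charK : p \in [pchar K].
Hypothesis n_le_p : (n <= p)%N.
Hypothesis n_gt3 : (3 < n)%N.
Hypothesis nil : Tcomm n `<=` [set 0 : A].

Local Notation P := (filt x y).

Let two_neq0 : (2%:R : K) != 0.
Proof. by rewrite -(dvdn_pcharf charK) gtnNdvd //; lia. Qed.

Lemma Tspace_filt_span d U : (2 < d)%N -> Tspace U -> P d.+1 `<=` U -> U `<=` P d ->
  U = mon_span x y d U.
Proof.
move=> d2 TU PU UP; have [D Dspec] := der_ex gen free infK.
apply: (Tspace_mon_span gen free infK (ltnW d2) TU PU _ UP) => a b i j w ijd Ww Uw.
have p3 : (3 < p)%N by lia.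
have n0 : (0 < n)%N by lia.
exact: (U_mon_mul gen Dspec charK n_le_p p3 n0 nil d2 TU PU a b ijd Ww Uw).
Qed.

Let I d : set A := Tcomm 3 `&` P d.

Let C d : set (set A) := [set U | [/\ Tspace U, I d.+1 `<=` U & U `<=` I d]].

(** A member of [C d] may fail to contain [P d.+1]; its completion falls under [Tspace_filt_span],
    and [hatI] recovers it. *)
Let hat d U : set A := tsum U (P d.+1).

Let hatT d U : Tspace U -> Tspace (hat d U).
Proof. by move=> TU; apply: Tspace_tsum => //; exact: (Tspace_filt gen). Qed.

Let P0 d : P d 0. Proof. exact: filt_zero. Qed.

Let P_hat d U : Tspace U -> P d.+1 `<=` hat d U.
Proof. by move=> [[U0 _ _] _]; exact: tsum_subr. Qed.

Let hat_P d U : C d U -> hat d U `<=` P d.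
Proof.
move=> [TU _ UI]; apply: tsum_min => [|u /UI[]//|u Pu].
  exact: (ideal_subspace (ideal_filt gen d)).
exact: filt_le Pu.
Qed.

(* Modular law, as [C d U] gives [P d.+1 `&` Tcomm 3 `<=` U `<=` Tcomm 3]. *)
Let hatI d U : C d U -> U = hat d U `&` Tcomm 3.
Proof.
move=> [TU IU UI]; apply/seteqP; split=> [u Uu|_ [[u [r [Uu Pr ->]]] Tur]].
  by split; [exact: tsum_subl|case: (UI u Uu)].
have [[_ UD _] _] := TU; apply: UD => //; apply: IU; split=> //.
have -> : r = u + r - u by rewrite addrC addKr.
by apply: TcommB => //; case: (UI u Uu).
Qed.

Let hat_span d U : (2 < d)%N -> C d U -> hat d U = mon_span x y d (hat d U).
Proof.
move=> d2 CU; have [TU _ _] := CU.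
by apply: Tspace_filt_span => //; [exact: hatT|exact: P_hat|exact: hat_P].
Qed.

Lemma Tnormal_chain_filt d : (2 < d)%N -> Tnormal_chain (I d.+1) (I d).
Proof.
move=> d2.
have TI e : Tspace (I e).
  by apply: TspaceI; [exact: Tspace_Tcomm|exact: (Tspace_filt gen)].
have II : I d.+1 `<=` I d by move=> u [Tu Pu]; split=> //; exact: filt_le Pu.
(* The measure is the dimension of [hat d U] inside the span of the words of degree [d]. This span
   contains the proper polynomials, which determine [hat d U]. *)
apply: (@Tnormal_chain_refine _ _ (C d) (fun U => span_rank (words x y d) (hat d U))).
- move=> U CU; have [TU _ _] := CU; split=> //.
  rewrite (hatI CU); apply: idealI; last exact: ideal_Tcomm.
  rewrite hat_span //; apply: (ideal_mon_span gen); first exact: ltnW.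
  exact: hatT.
- move=> U V T [TU IU _] [_ _ VI] TT UT TV; split=> //.
    exact: subset_trans UT.
  exact: subset_trans TV VI.
- move=> U V CU CV UV rk.
  have [TU _ _] := CU; have [TV _ _] := CV.
  have UVh : hat d U `<=` hat d V.
    by move=> _ [u [r [Uu Pr ->]]]; exists u, r; split=> //; exact: UV.
  have [sU _] := hatT d TU; have [sV _] := hatT d TV.
  have Wh w : proper_homog x y d w -> hat d V w -> hat d U w.
    by move=> /proper_homog_words; exact: (span_rank_eq sU sV UVh rk).
  have hVU : hat d V `<=` hat d U.
    move=> v; rewrite (hat_span d2 CV) => Lv.
    elim: v / Lv => [r Pr|u v _ Lu _ Lv|a b w Ww Uw].
    + exact: P_hat.
    + by have [_ UD _] := sU; exact: UD.
    + rewrite (hat_span d2 CU); apply: mon_span_mon => //; exact: Wh.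
  by rewrite (hatI CU) (hatI CV) => v [hv Tv]; split=> //; exact: hVU.
- by split.
- by split.
- exact: II.
Qed.

Lemma Tnormal_chain_Tcomm3 : Tnormal_chain [set 0] (@Tcomm K A 3).
Proof.
have IE : I (n + n) = [set 0].
  apply/seteqP; split=> [u [_ Pu]|_ ->]; last by split; [exact: Tcomm0|exact: filt_zero].
  by apply: (filt_eq0 gen two_neq0 nil _ _ Pu); lia.
have I3 : I 3 = Tcomm 3.
  by apply/seteqP; split=> [u []//|u Tu]; split=> //; exact: (Tcomm_filt gen).
have chain d : Tnormal_chain (I (3 + d)) (I 3).
  elim: d => [|d IH].
    rewrite I3; apply: Tnormal_nil; [exact: Tspace_Tcomm|exact: ideal_Tcomm].
  by apply: Tnormal_trans IH; rewrite addnS; exact: Tnormal_chain_filt.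
by have := chain (n + n - 3)%N; rewrite subnKC ?IE ?I3 //; lia.
Qed.

Lemma Tnormal_series_Tcomm3 : Tcomm 3 != [set 0] :> set A ->
  (exists k V, Tnormal_series (@Tcomm K A 3) k V) /\
  (forall W : set A, Tspace W -> W `<=` Tcomm 3 -> exists s : seq A, W = Tspan [set` s]).
Proof.
move=> T3; split; last first.
  move=> W TW WT; have [s [sW Ws]] := Tnormal_chain_fg Tnormal_chain_Tcomm3 TW WT.
  exists s; apply/seteqP; split; last exact: Tspan_min.
  by move=> w /Ws[u [v [su -> ->]]]; rewrite addr0.
(* A composition series has at least one factor, so the chain of length 0 is ruled out by [T3]. *)
have [[|k] [V [V0 Vk VT VC]]] := Tnormal_chain_series Tnormal_chain_Tcomm3.
  by move: T3; rewrite -Vk V0 eqxx.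
exists k, V; split; last by move=> i /VT[].
by split=> // i /VT[].
Qed.

End Assembly.

(** * The relatively free algebra *)

Section Factorization.
Variables (K : comNzRingType) (F A B : algType K).
Variables (pi : {lrmorphism F -> A}) (ev : {lrmorphism F -> B}).
Hypothesis pi_surj : forall q, exists u, pi u = q.
Hypothesis pi_ker : forall u, pi u = 0 -> ev u = 0.

Definition factor (q : A) : B := ev (projT1 (cid (pi_surj q))).

Lemma factorE u : factor (pi u) = ev u.
Proof.
rewrite /factor; case: cid => v /= pv; apply/eqP; rewrite -subr_eq0.
by rewrite -rmorphB /= pi_ker // rmorphB /= pv subrr.
Qed.

Fact factor_nmod : nmod_morphism factor.
Proof.
split=> [|q r]; first by rewrite -(rmorph0 pi) factorE rmorph0.
have [u <-] := pi_surj q; have [v <-] := pi_surj r.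
by rewrite -rmorphD !factorE rmorphD.
Qed.

Fact factor_monoid : monoid_morphism factor.
Proof.
split=> [|q r]; first by rewrite -(rmorph1 pi) factorE rmorph1.
have [u <-] := pi_surj q; have [v <-] := pi_surj r.
by rewrite -rmorphM !factorE rmorphM.
Qed.

Fact factor_scalable : scalable factor.
Proof.
move=> c q; have [u <-] := pi_surj q.
by rewrite -linearZ !factorE linearZ.
Qed.

HB.instance Definition _ := GRing.isNmodMorphism.Build A B factor factor_nmod.
HB.instance Definition _ := GRing.isMonoidMorphism.Build A B factor factor_monoid.
HB.instance Definition _ := GRing.isScalable.Build K A B *:%R factor factor_scalable.

Lemma factor_ex : exists phi : {lrmorphism A -> B}, forall u, phi (pi u) = ev u.
Proof. by exists factor; exact: factorE. Qed.

End Factorization.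

Lemma generates_surj (K : comNzRingType) (F A : algType K)
    (pi : {lrmorphism F -> A}) (x y : F) :
  (forall q, exists u, pi u = q) -> generates x y -> generates (pi x) (pi y).
Proof.
move=> pi_surj gen S Sx Sy SC SD SM q; have [u <-] := pi_surj q.
move: u; apply: (gen [set u | S (pi u)]) => //=.
- by move=> c; rewrite linearZ rmorph1; exact: SC.
- by move=> u v Su Sv; rewrite rmorphD; exact: SD.
- by move=> u v Su Sv; rewrite rmorphM; exact: SM.
Qed.

(** * The universal property of the free algebra *)

Section Evaluation.
Variables (K : comNzRingType) (B : algType K) (f g : B).

Definition F2_letters (m : {fmonom 'I_2}) : B :=
  \prod_(i <- fmonom_val m) (if i == ord0 then f else g).

Fact F2_letters_mmorphism : mmorphism F2_letters.
Proof.
by split=> [m m'|]; rewrite /F2_letters ?fmM ?big_cat // fm1 big_nil.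
Qed.

HB.instance Definition _ := monalg.isMultiplicative.Build {fmonom 'I_2} B F2_letters
  F2_letters_mmorphism.

Definition F2_eval (u : F2 K) : B := mmap (in_alg B) F2_letters u.

Fact F2_eval_nmod : nmod_morphism F2_eval.
Proof. by split; [exact: mmap0|exact: mmapD]. Qed.

Fact F2_eval_monoid : monoid_morphism F2_eval.
Proof.
have comm_alg (k : K) (z : B) : GRing.comm (in_alg B k) z.
  by rewrite /GRing.comm /= mulr_algl mulr_algr.
have [HM H1] := @commr_mmap_is_multiplicative _ _ _ (in_alg B) F2_letters
  (fun u m m' => comm_alg _ _).
by split.
Qed.

Fact F2_eval_scalable : scalable F2_eval.
Proof.
move=> c u; rewrite /F2_eval; apply: (etrans (mmapZ _ _)).
by rewrite /= mulr_algl.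
Qed.

HB.instance Definition _ := GRing.isNmodMorphism.Build (F2 K) B F2_eval F2_eval_nmod.
HB.instance Definition _ := GRing.isMonoidMorphism.Build (F2 K) B F2_eval
  F2_eval_monoid.
HB.instance Definition _ := GRing.isScalable.Build K (F2 K) B *:%R F2_eval
  F2_eval_scalable.

End Evaluation.

Definition F2_gen (K : comNzRingType) (i : 'I_2) : F2 K := mkmalgU (fmu i) 1.

Lemma F2_eval_gen (K : comNzRingType) (B : algType K) (f g : B) (i : 'I_2) :
  F2_eval f g (F2_gen K i) = if i == ord0 then f else g.
Proof.
rewrite /F2_eval /F2_gen; apply: (etrans (mmapU _ _)).
by rewrite /= scale1r mul1r /F2_letters fmU big_seq1.
Qed.

Lemma F2_gen_generates (K : comNzRingType) :
  generates (F2_gen K ord0) (F2_gen K ord_max).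
Proof.
move=> S Sx Sy SC SD SM u.
have S1 : S 1 by rewrite -[1]scale1r; exact: SC.
have Sm (m : {fmonom 'I_2}) : S (mkmalgU m 1).
  rewrite -[m]fmK; elim: (fmonom_val m) => [|i s IH].
    by rewrite -fmoneE.
  have -> : mkmalgU (FMonom (i :: s)) 1 = F2_gen K i * mkmalgU (FMonom s) 1 :> F2 K.
    rewrite malgM_def fgmulUU mulr1; congr mkmalgU.
    by apply/eqP; rewrite fmP /= fmM fmU.
  apply: SM => //; case: (unliftP ord_max i) => [j ->|-> //].
  by rewrite (ord1 j); have -> : lift ord_max ord0 = ord0 :> 'I_2 by exact/val_inj.
rewrite [u]monalgE; elim/big_ind: _ => [||m _] //.
  by rewrite -(scale0r 1); exact: SC.
have -> : << u@_m *g m >> = (u@_m)%:A * mkmalgU m 1 :> F2 K.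
  rewrite -scalerAl mul1r; apply/malgP => k.
  by rewrite mcoeffZ !mcoeffU mulr_natr.
exact: SM.
Qed.

Section RelativelyFree.
Variables (K : fieldType) (n : nat) (n_gt1 : (1 < n)%N).

Local Notation A := (F2rel K n_gt1).
Let pi : {lrmorphism F2 K -> A} := @alg_pi K (F2 K) (@F2_Tcomm K n n_gt1).

Let pi_surj (q : A) : exists u, pi u = q. Proof. exact: alg_pi_surj. Qed.

Let pi_eq0 (u : F2 K) : pi u = 0 <-> Tcomm n u.
Proof.
split=> [/eqP|Tu].
  by rewrite alg_pi_eq0 => /asboolP.
by apply/eqP; rewrite alg_pi_eq0; apply/asboolP.
Qed.

Definition F2rel_x : A := pi (F2_gen K ord0).
Definition F2rel_y : A := pi (F2_gen K ord_max).

Lemma F2rel_generates : generates F2rel_x F2rel_y.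
Proof. exact: (generates_surj pi_surj (@F2_gen_generates K)). Qed.

Lemma F2rel_nilpotent : Tcomm n `<=` [set 0 : A].
Proof.
apply: Tcomm_min => [|s sz].
  by split=> [//|u v -> ->|a u ->|a u ->]; rewrite ?addr0 ?mulr0 ?mul0r.
have [s' s'E] : exists s', s = map pi s'.
  elim: s {sz} => [|q s [s' ->]]; first by exists [::].
  by have [u <-] := pi_surj q; exists (u :: s').
rewrite s'E -lcomm_morph; apply/pi_eq0; rewrite -sz s'E size_map.
exact: Tcomm_lcomm.
Qed.

(** Evaluation of [F2 K] in [A] maps T^(n) into T^(n) of [A], which is zero, and therefore factors
    through the quotient. *)
Lemma F2rel_free : free_on F2rel_x F2rel_y.
Proof.
move=> f g; pose ev : {lrmorphism F2 K -> A} := F2_eval f g.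
have [u /pi_eq0 Tu|phi phiE] := @factor_ex _ _ _ _ pi ev pi_surj.
  exact: (F2rel_nilpotent (Tcomm_morph ev Tu)).
exists phi; rewrite /F2rel_x /F2rel_y !phiE.
by split; apply: (etrans (F2_eval_gen f g _)).
Qed.

End RelativelyFree.

(* Upper triangular 4 x 4 matrices with constant diagonal satisfy
   [a, b, c, d] = 0, while [a, b, b] need not vanish. *)
Section UpperTriangular.
Variable K : fieldType.
Implicit Types M N : 'M[K]_4.

Definition strict k M : Prop := forall i j : 'I_4, (j < i + k)%N -> M i j = 0.

Let strictD k M N : strict k M -> strict k N -> strict k (M + N).
Proof. by move=> SM SN i j ij; rewrite mxE SM // SN // addr0. Qed.

Let strictZ k (c : K) M : strict k M -> strict k (c *: M).
Proof. by move=> SM i j ij; rewrite mxE SM // mulr0. Qed.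

Let strictM k l M N : strict k M -> strict l N -> strict (k + l) (M * N).
Proof.
move=> SM SN i j ij; rewrite [LHS]mxE big1 // => m _.
have [mi|im] := ltnP m (i + k)%N; first by rewrite SM // mul0r.
by rewrite SN ?mulr0 //; lia.
Qed.

Let strict_le k l M : (k <= l)%N -> strict l M -> strict k M.
Proof. by move=> kl SM i j ij; apply: SM; lia. Qed.

Definition unitri M : Prop := exists (c : K) N, strict 1 N /\ M = c%:A + N.

Let strict_comm k M N : strict k M -> unitri N -> strict k.+1 (comm M N).
Proof.
move=> SM [c [N' [SN ->]]]; rewrite commDr commA add0r -addn1 /comm -scaleN1r.
by apply: strictD; [|apply: strictZ; rewrite addnC]; exact: strictM.
Qed.

Lemma unitri_lcomm (s : seq 'M[K]_4) : (forall M, M \in s -> unitri M) ->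
  size s = 4 -> lcomm s = 0.
Proof.
case: s => [|a [|b [|c [|d [|? ?]]]]] // Hs _ /=.
have Ha : unitri a by apply: Hs; rewrite !inE eqxx.
have Hb : unitri b by apply: Hs; rewrite !inE eqxx orbT.
have Hc : unitri c by apply: Hs; rewrite !inE eqxx !orbT.
have Hd : unitri d by apply: Hs; rewrite !inE eqxx !orbT.
have [k [N [SN aE]]] := Ha.
(* The scalar part of [a] is central. Each of the three brackets climbs one superdiagonal, and
   [strict 4] means zero in size 4. *)
have S2 : strict 2 (comm a b).
  by rewrite aE commDl [comm _%:A b]commN commA oppr0 add0r; exact: strict_comm.
have S4 := strict_comm (strict_comm S2 Hc) Hd.
by apply/matrixP => i j; rewrite S4 ?mxE //; have := ltn_ord j; lia.
Qed.

Lemma F2_eval_unitri (f g : 'M[K]_4) (u : F2 K) : strict 1 f -> strict 1 g ->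
  unitri (F2_eval f g u).
Proof.
move=> Sf Sg; move: u.
have S0 : strict 1 0 by move=> i j _; rewrite mxE.
apply: (F2_gen_generates (S := [set u | unitri (F2_eval f g u)])) => /=.
- by exists 0, f; rewrite F2_eval_gen scale0r add0r.
- by exists 0, g; rewrite F2_eval_gen scale0r add0r.
- by move=> c; exists c, 0; rewrite linearZ rmorph1 addr0.
- move=> u v [c [N [SN uE]]] [c' [N' [SN' vE]]]; exists (c + c'), (N + N').
  by split; [exact: strictD|rewrite rmorphD /= uE vE scalerDl addrACA].
- move=> u v [c [N [SN uE]]] [c' [N' [SN' vE]]].
  exists (c * c'), (c *: N' + c' *: N + N * N'); split.
    apply: strictD; first by apply: strictD; exact: strictZ.
    by apply: (@strict_le _ (1 + 1)) => //; exact: strictM.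
  rewrite rmorphM /= uE vE mulrDl !mulrDr -!scalerAl -!scalerAr !mul1r mulr1.
  by rewrite scalerA !addrA.
Qed.

Lemma F2_comm_notin_Tcomm4 : ~ Tcomm 4
  (lcomm [:: F2_gen K ord0; F2_gen K ord_max; F2_gen K ord_max]).
Proof.
pose E i j : 'M[K]_4 := delta_mx (inord i) (inord j).
have EM i j k l : (j < 4)%N -> (k < 4)%N ->
    E i j * E k l = if j == k then E i l else 0.
  move=> j4 k4; rewrite /E -[_ * _]/(_ *m _) mul_delta_mx_cond.
  by rewrite -val_eqE /= !inordK //; case: eqP.
have SE i j : (i < j)%N -> (j < 4)%N -> strict 1 (E i j).
  move=> ij j4 k l lk; rewrite mxE -!val_eqE /= !inordK //; last exact: ltn_trans j4.
  by rewrite (_ : _ && _ = false) //; lia.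
(* Chosen so that [[f, g] = E 0 2] and [[f, g, g] = E 0 3]. *)
pose f := E 0 1; pose g := E 1 2 + E 2 3.
have Sf : strict 1 f by exact: SE.
have Sg : strict 1 g by apply: strictD; exact: SE.
set w := lcomm _ => T4; have : F2_eval f g w = 0.
  move: T4; apply: (@Tcomm_min _ _ 4 [set u | F2_eval f g u = 0]).
    split=> [|u v /= u0 v0|a u /= u0|a u /= u0] /=.
    - by rewrite rmorph0.
    - by rewrite rmorphD /= u0 v0 addr0.
    - by rewrite rmorphM /= u0 mulr0.
    - by rewrite rmorphM /= u0 mul0r.
  move=> s sz /=; rewrite lcomm_morph; apply: unitri_lcomm; last by rewrite size_map.
  by move=> M /mapP[u _ ->]; exact: F2_eval_unitri.
have fg : comm f g = E 0%N 2%N by rewrite /comm /f /g mulrDl mulrDr !EM // !addr0 subr0.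
have fgg : comm (E 0%N 2%N) g = E 0%N 3%N.
  by rewrite /comm /g mulrDl mulrDr !EM // add0r addr0 subr0.
rewrite lcomm_morph /= !F2_eval_gen /= fg fgg /E.
move/matrixP/(_ (inord 0) (inord 3)); rewrite !mxE !eqxx /= => /eqP.
by rewrite oner_eq0.
Qed.

(** Otherwise [[x, y, y]] would lie in T^(n), hence in T^(4), of the free algebra. *)
Lemma F2rel_Tcomm3_neq0 n (n_gt1 : (1 < n)%N) : (3 < n)%N ->
  @Tcomm K (F2rel K n_gt1) 3 != [set 0] :> set (F2rel K n_gt1).
Proof.
move=> n3; apply/eqP => T3.
apply: F2_comm_notin_Tcomm4.
set s := [:: _; _; _].
pose pi : {lrmorphism F2 K -> F2rel K n_gt1} :=
  @alg_pi K (F2 K) (@F2_Tcomm K n n_gt1).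
apply: (@Tcomm_le _ _ 4 n) => //.
have : Tcomm 3 (lcomm (map pi s)) by exact: (@Tcomm_lcomm _ _ (map pi s)).
rewrite T3 -lcomm_morph => /= /eqP.
by rewrite alg_pi_eq0 => /asboolP.
Qed.

End UpperTriangular.

Theorem mainTheorem7 (K : fieldType) (p n : nat)
    (n_ge4 : (4 <= n)%N) (K_infinite : infinite_set [set: K])
    (charK : p \in [pchar K]) (p_ge_n : (n <= p)%N) (p_ge5 : (5 <= p)%N) :
  let A : algType K := F2rel K (ltnW (ltnW n_ge4)) in
  (exists (k : nat) (V : nat -> set A), Tnormal_series (Tcomm 3) k V) /\
  (forall W : set A, Tspace W -> W `<=` Tcomm 3 ->
     exists s : seq A, W = Tspan [set` s]).
Proof.
have n_gt1 := ltnW (ltnW n_ge4).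
apply: (Tnormal_series_Tcomm3 (@F2rel_generates K n _) (@F2rel_free K n _)
  K_infinite charK p_ge_n n_ge4 (@F2rel_nilpotent K n _)).
exact: F2rel_Tcomm3_neq0.
Qed.
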